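(* Let $X$ and $Y$ be complex Banach spaces and $T,S\in\mathcal{L}(X,Y)$. Assume that for each $\lambda$ in an open, connected set $\Omega\subset\mathbb{C}$ the operator $T-\lambda S \in\mathcal{L}(X,Y)$ is Fredholm, and that the dimension of the null space $N(T-\lambda S)$ does not depend on $\lambda\in\Omega$. Let $U$ be a bounded, open and connected set with $U\subset\overline{U}\subset\Omega$. Then there exists a generalized resolvent for $\lambda\mapsto T-\lambda S$ on $U$.
   Context: $\mathcal{L}(X,Y)$ is the Banach space of bounded linear operators from $X$ to $Y$; $N(A)$ and $R(A)$ denote kernel and range. An operator is Fredholm if its kernel has finite dimension and its range has finite codimension. For an open set $U\subset\mathbb{C}$, a function $U\ni\lambda\mapsto G(\lambda)\in\mathcal{L}(Y,X)$ is called a generalized resolvent on $U$ of the linear pencil $\lambda\mapsto T-\lambda S$ if: (1) $(T-\lambda S)G(\lambda)(T-\lambda S)=T-\lambda S$ for all $\lambda\in U$; (2) $G(\lambda)(T-\lambda S)G(\lambda)=G(\lambda)$ for all $\lambda\in U$; (3) $G(\lambda)-G(\mu)=(\lambda-\mu)G(\lambda)SG(\mu)$ for all $\lambda$ and $\mu$ in the same connected component of $U$. *)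

(* Defs.v *)
From HB Require Import structures.
From mathcomp Require Import all_boot all_order all_algebra.
From mathcomp Require Import all_classical all_reals all_analysis.
From mathcomp Require Import complex.

Set Implicit Arguments.
Unset Strict Implicit.
Unset Printing Implicit Defensive.

Import Order.TTheory GRing.Theory Num.Theory.
Import numFieldNormedType.Exports.

Local Open Scope classical_set_scope.
Local Open Scope ring_scope.

(* [R[i]] carries no topology on its own; presenting it as a [numFieldType]
   gives it the topology and the norm attached to every such field. *)
Definition Cplx (R : realType) : numFieldType := R[i].

Section operators.
Context {K : numFieldType}.

(* Norms take their values in the scalar field, so the bound [M] does too. *)
Definition bounded_operator (V W : normedModType K) (A : {linear V -> W}) :=
  exists M : K, forall x, `|A x| <= M * `|x|.

Definition has_dim (V : lmodType K) (E : set V) (n : nat) :=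
  exists e : 'I_n -> V,
    (forall a : 'I_n -> K, \sum_i a i *: e i = 0 -> forall i, a i = 0) /\
    E = range (fun a : 'I_n -> K => \sum_i a i *: e i).

(* The classes of the [e i] form a basis of the quotient [V / E]. *)
Definition has_codim (V : lmodType K) (E : set V) (n : nat) :=
  exists e : 'I_n -> V,
    (forall a : 'I_n -> K, E (\sum_i a i *: e i) -> forall i, a i = 0) /\
    (forall v, exists a : 'I_n -> K, E (v - \sum_i a i *: e i)).

Definition nullspace (V W : lmodType K) (A : {linear V -> W}) : set V :=
  [set x | A x = 0].

Definition fredholm (V W : lmodType K) (A : {linear V -> W}) :=
  (exists n, has_dim (nullspace A) n) /\ (exists n, has_codim (range A) n).

Definition pencil (V W : lmodType K) (T S : {linear V -> W}) (l : K)
  : {linear V -> W} := T \- l \*: S.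

(* Only the values of [G] on [U] matter. *)
Definition generalized_resolvent (X Y : normedModType K) (T S : {linear X -> Y})
    (U : set K) (G : K -> {linear Y -> X}) :=
  [/\ forall l, U l -> bounded_operator (G l),
      forall l, U l -> pencil T S l \o G l \o pencil T S l =1 pencil T S l,
      forall l, U l -> G l \o pencil T S l \o G l =1 G l
    & forall l m, U l -> connected_component U l m ->
        forall y, G l y - G m y = (l - m) *: G l (S (G m y))].

End operators.

(* Main.v *)
From HB Require Import structures.
Require Import Defs.
From mathcomp Require Import all_boot all_order all_algebra perm.
From mathcomp Require Import all_classical all_reals all_analysis.
From mathcomp Require Import complex.
From mathcomp Require Import ring lra.

Set Implicit Arguments.
Unset Strict Implicit.
Unset Printing Implicit Defensive.

Import Order.TTheory GRing.Theory Num.Theory.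
Import numFieldNormedType.Exports.

Local Open Scope classical_set_scope.
Local Open Scope ring_scope.

(**
A generalized resolvent exists as soon as all null spaces [N(T - l S)] have a
common closed complement [M] and all ranges [R(T - l S)] a common complement
[W]: take for [G l] the operator that vanishes on [W] and inverts
[T - l S : M -> R(T - l S)].  The identity
[G l - G m = (l - m) G l S G m] follows because
[(l - m) S = (T - m S) - (T - l S)].  With [M] the common kernel of functionals
[f_1, ..., f_n] and [W] spanned by vectors [w_1, ..., w_k], this says that the
bordered system [y = (T - l S) x + sum c_j w_j], [f_i x = 0] is uniquely
solvable for every [l] ([resolvent_exists]).

At one point [l0] such [f] and [w] exist by Hahn-Banach ([dual_basis]) and the
Fredholm property, the bordered system has a bounded inverse by Zabreiko's
lemma ([bordered_inverse]), and a Neumann series keeps it solvable near [l0]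
([perturb_bordered]).  Since the null spaces have constant dimension, this also
gives bases of [N(T - l S)] and of the annihilator of [R(T - l S)] that depend
on [l] in a controlled way ([local_system_exists]); in particular the
codimension of the range is constant on the connected set.

The same [f] may fail far from [l0], where the matrix of the values of the
[f_i] on a basis of [N(T - l S)] becomes singular.  Here the linearity of the
pencil enters.  If a combination [g] of the [f_i] vanishes on [N(T - l0 S)],
then [g = h o (T - l0 S)] for a bounded functional [h], and on [N(T - l S)],
where [T x = l S x], one has [g = (l - l0) (h o S)].  Replacing one of the [f_i]
by [h o S] divides the determinant by [l - l0] and changes nothing at other
points.  The vectors [w_j] are treated in the same way: if a combination
[y = (T - l0 S) x] lies in [R(T - l0 S)], then [y] is congruent to
[(l - l0) S x] modulo [R(T - l S)].  Both cases are instances of one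
statement about tuples in a space with a family of subspaces of finite
codimension ([remove_all_zeros]).

The order of vanishing is controlled by estimates in place of power series.  The
norms of the tuples grow at most geometrically under repeated division, so a
point where the division never ends has a neighbourhood in which the determinant
is at most [N 2^-k] for all [k], hence zero ([zero_dichotomy]).  By connectedness
this happens nowhere, so the singular points are isolated, a compact set contains
finitely many of them, and they are removed one at a time.
*)

(** * Real-valued norms over the complex numbers *)

Section RealNorm.
Context {R : realType}.
Local Notation K := (Cplx R).

(** Norms of the spaces at hand are complex numbers; their real values live in a
    totally ordered field, where all estimates are made. *)
Definition nm (V : normedZmodType K) (x : V) : R := complex.Re (`|x| : R[i]).

Lemma normE (V : normedZmodType K) (x : V) : `|x| = ((nm x)%:C)%C :> R[i].
Proof.
have h : (0 : R[i]) <= (`|x| : R[i]) by exact: (normr_ge0 x).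
by rewrite /nm [LHS]complexE (ger0_Im h) mulr0 addr0.
Qed.

Lemma nm_ge0 (V : normedZmodType K) (x : V) : 0 <= nm x.
Proof. by rewrite -ler0c -normE; exact: (normr_ge0 x). Qed.

Lemma nmD (V : normedZmodType K) (x y : V) : nm (x + y) <= nm x + nm y.
Proof.
rewrite -lecR rmorphD /= -!normE; exact: (ler_normD x y).
Qed.

Lemma nmN (V : normedZmodType K) (x : V) : nm (- x) = nm x.
Proof. by rewrite /nm normrN. Qed.

Lemma nmBC (V : normedZmodType K) (x y : V) : nm (x - y) = nm (y - x).
Proof. by rewrite -nmN opprB. Qed.

Lemma nm0 (V : normedZmodType K) : nm (0 : V) = 0.
Proof. by rewrite /nm normr0. Qed.

Lemma nm_eq0 (V : normedZmodType K) (x : V) : nm x = 0 -> x = 0.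
Proof.
by move=> h; apply/eqP; rewrite -(normr_eq0 x); apply/eqP; rewrite [LHS]normE h.
Qed.

Lemma nm_gt0 (V : normedZmodType K) (x : V) : x != 0 -> 0 < nm x.
Proof.
by move=> x0; rewrite lt_neqAle nm_ge0 andbT eq_sym; apply: contraNneq x0 => /nm_eq0->.
Qed.

Lemma nmZ (V : normedModType K) (a : K) (x : V) : nm (a *: x) = nm a * nm x.
Proof. 
have := normrZ a x => h; apply: complexI; rewrite rmorphM /= -!normE; exact: h.
Qed.

Lemma nmM (a b : K) : nm (a * b) = nm a * nm b.
Proof. by apply: complexI; rewrite rmorphM /= -!normE; exact: normrM. Qed.

Lemma nm1 : nm (1 : K) = 1.
Proof. by rewrite /nm normr1. Qed.

Lemma nmX (a : K) k : nm (a ^+ k) = nm a ^+ k.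
Proof. by elim: k => [|k ih]; rewrite ?nm1// !exprS nmM ih. Qed.

Lemma nmV (a : K) : nm (a^-1) = (nm a)^-1.
Proof.
have [->|a0] := eqVneq a 0; first by rewrite invr0 nm0 invr0.
apply: (mulfI (lt0r_neq0 (nm_gt0 a0))).
by rewrite -nmM divff// nm1 divff// lt0r_neq0// nm_gt0.
Qed.

Lemma nm_real (a : R) : nm ((a%:C)%C : K) = `|a|.
Proof.
by apply: complexI; rewrite -normE [LHS]normc_def /= expr0n /= addr0 sqrtr_sqr.
Qed.

Lemma nm_sum (V : normedZmodType K) (I : finType) (F : I -> V) :
  nm (\sum_i F i) <= \sum_i nm (F i).
Proof.
elim/big_ind2 : _ => //; first by rewrite nm0.
by move=> a b c d h1 h2; apply: le_trans (nmD _ _) (lerD _ _).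
Qed.

Lemma pos_real (e : K) : 0 < e -> exists2 r : R, 0 < r & e = (r%:C)%C.
Proof.
move=> e0.
have eE : e = ((complex.Re (e : R[i]))%:C)%C :> R[i].
  by rewrite [LHS]complexE (ger0_Im (ltW e0)) mulr0 addr0.
exists (complex.Re (e : R[i])) => //.
by have := e0; rewrite {1}eE => h0; rewrite -(ltcR 0); exact: h0.
Qed.

Lemma nbhs_nm (V : normedModType K) (x : V) (P : set V) :
  nbhs x P <-> exists2 r : R, 0 < r & forall y, nm (x - y) < r -> P y.
Proof.
split.
- move=> /nbhs_ballP[e /= /pos_real[r r0 ->] h]; exists r => // y hy; apply: h.
  by rewrite -ball_normE /ball_ /=; have := hy; rewrite -ltcR -normE.
- move=> [r r0 h]; apply/nbhs_ballP.
  exists ((r%:C)%C : K) => /=; first by rewrite -ltcR in r0; exact: r0.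
  move=> y; rewrite -ball_normE /ball_ /= => hy; apply: h.
  by rewrite -ltcR -normE.
Qed.

Lemma bounded_operatorP (V W : normedModType K) (A : {linear V -> W}) :
  bounded_operator A <-> exists2 C : R, 0 <= C & forall x, nm (A x) <= C * nm x.
Proof.
split.
- move=> [M hM]; exists `|complex.Re (M : R[i])| => // x.
  have /(_ x) := hM => hx.
  have {}hx : (((nm (A x))%:C)%C : R[i]) <= (M : R[i]) * ((nm x)%:C)%C.
    by rewrite -!normE; exact: hx.
  move: hx; rewrite lecE => /andP[_ /=].
  case: (M : R[i]) => a b /=; rewrite mulr0 subr0 => /le_trans; apply.
  by apply: ler_wpM2r; [exact: nm_ge0 | exact: ler_norm].
- move=> [C C0 h]; exists ((C%:C)%C : K) => x.
  have := h x; rewrite -lecR rmorphM /= -!normE; exact.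
Qed.

End RealNorm.

(** * Completeness and Neumann series *)

Section Completeness.
Context {R : realType}.
Local Notation K := (Cplx R).

Lemma halfX_gt0 n : 0 < (2^-1 : R) ^+ n.
Proof. by rewrite exprn_gt0. Qed.

Lemma halfX_small (a e : R) : 0 < e -> exists n, a * 2^-1 ^+ n < e.
Proof.
move=> e0; have [n hn] : exists n : nat, a / e < n%:R.
  exists (Num.truncn (a / e)).+1; exact: truncnS_gt.
exists n; rewrite exprVn -ltr_pdivlMr ?invr_gt0 ?exprn_gt0// invrK.
rewrite mulrC -ltr_pdivrMr//; apply: lt_le_trans hn _.
by rewrite -natrX ler_nat ltnW// ltn_expl.
Qed.

Lemma le_halfX_le0 (a b : R) : (forall n, a <= b * 2^-1 ^+ n) -> a <= 0.
Proof.
move=> h; rewrite leNgt; apply/negP => a0.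
by have [n] := halfX_small b a0; rewrite ltNge h.
Qed.

Lemma nm_halfX_eq0 (V : normedZmodType K) (x : V) (b : R) :
  (forall n, nm x <= b * 2^-1 ^+ n) -> x = 0.
Proof. by move/le_halfX_le0 => h; apply/nm_eq0/le_anti; rewrite h nm_ge0. Qed.

(** The function [d] stands for the distance of the terms [n] and [m] of a sequence, in a
    normed space as well as in the reals. *)
Lemma geometric_tail (d : nat -> nat -> R) (C : R) :
  (forall n m, 0 <= d n m) -> (forall n, d n n = 0) ->
  (forall n m, d n m.+1 <= d n m + d m m.+1) ->
  (forall n, d n n.+1 <= C * 2^-1 ^+ n) ->
  forall n m, (n <= m)%N -> d n m <= 2 * C * 2^-1 ^+ n.
Proof.
move=> d_ge0 d0 dS h n m le_nm; rewrite -(subnKC le_nm).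
have C0 : 0 <= C.
  by apply: le_trans (d_ge0 0%N 1%N) _; rewrite -[leRHS]mulr1 -(expr0 2^-1).
suff : d n (n + (m - n))%N <= 2 * C * 2^-1 ^+ n - 2 * C * 2^-1 ^+ (n + (m - n)).
  move=> /le_trans; apply; rewrite gerBl.
  by rewrite !mulr_ge0// ltW// halfX_gt0.
elim: (m - n)%N => [|k ih]; first by rewrite addn0 d0 subrr.
rewrite addnS; apply: le_trans (dS _ _) _; apply: le_trans (lerD ih (h _)) _.
by rewrite exprS; set q := _ ^+ (n + k); set p := _ ^+ n; lra.
Qed.

(** Completeness for sequences with geometrically decaying steps. The constant 4,
    twice the sum of the geometric series, covers the complex numbers, where real
    and imaginary parts are handled separately. *)
Definition geo_complete (V : normedZmodType K) :=
  forall (u : nat -> V) (C : R), (forall n, nm (u n.+1 - u n) <= C * 2^-1 ^+ n) ->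
  exists l, forall n, nm (l - u n) <= 4 * C * 2^-1 ^+ n.

Lemma banach_geo_complete (V : completeNormedModType K) : geo_complete V.
Proof.
move=> u C h.
have C0 : 0 <= C.
  apply: le_trans (nm_ge0 (u 1%N - u 0%N)) _.
  by rewrite -[leRHS]mulr1 -(expr0 2^-1).
have tail n m : (n <= m)%N -> nm (u m - u n) <= 2 * C * 2^-1 ^+ n.
  apply: (@geometric_tail (fun n m => nm (u m - u n))) => //.
  - by move=> *; exact: nm_ge0.
  - by move=> k; rewrite subrr nm0.
  - move=> i j; rewrite (_ : u j.+1 - u i = (u j - u i) + (u j.+1 - u j)).
      exact: nmD.
    by rewrite [RHS]addrC subrKA.
have : cvg (u @ \oo).
  apply: cauchy_cvg; apply: cauchy_exP => e e0.
  have [r r0 rE] := pos_real e0.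
  have [n hn] := halfX_small (2 * C) r0.
  exists (u n), n => // m /= le_nm; rewrite /= -ball_normE /ball_ /= rE.
  by rewrite [X in X < _]normE ltcR nmBC; exact: le_lt_trans (tail _ _ le_nm) hn.
move=> /cvg_ex[l /= ul]; exists l => n.
suff : nm (l - u n) <= 2 * C * 2^-1 ^+ n.
  by move=> /le_trans; apply; rewrite !ler_wpM2r ?ler_nat// ltW// halfX_gt0.
apply/ler_addgt0Pr => r r0.
have /ul : nbhs l [set y | nm (l - y) < r] by apply/nbhs_nm; exists r.
move=> [N _ hN].
have /= := hN (maxn N n) (leq_maxl _ _) => h1.
rewrite (_ : l - u n = (l - u (maxn N n)) + (u (maxn N n) - u n)); last first.
  by rewrite subrKA.
apply: le_trans (nmD _ _) _; rewrite addrC.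
by apply: lerD (ltW h1); apply: tail; exact: leq_maxr.
Qed.

Lemma real_geo_complete (u : nat -> R) (C : R) :
  (forall n, `|u n.+1 - u n| <= C * 2^-1 ^+ n) ->
  exists l, forall n, `|l - u n| <= 2 * C * 2^-1 ^+ n.
Proof.
move=> h.
have tail n m : (n <= m)%N -> `|u m - u n| <= 2 * C * 2^-1 ^+ n.
  apply: (@geometric_tail (fun n m => `|u m - u n|)) => //.
  - by move=> k; rewrite subrr normr0.
  - move=> i j; rewrite (_ : u j.+1 - u i = (u j - u i) + (u j.+1 - u j)).
      exact: ler_normD.
    by rewrite [RHS]addrC subrKA.
pose a n := u n - 2 * C * 2^-1 ^+ n.
pose b n := u n + 2 * C * 2^-1 ^+ n.
have C0 : 0 <= C.
  by apply: (le_trans (normr_ge0 (u 1%N - u 0%N))); rewrite -[leRHS]mulr1 -(expr0 2^-1).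
have p0 n : 0 <= 2 * C * 2^-1 ^+ n by rewrite !mulr_ge0// ltW// halfX_gt0.
have ab n m : a n <= b m.
  rewrite /a /b; case: (leqP n m) => [le_nm|/ltnW le_mn];
    [have := tail _ _ le_nm | have := tail _ _ le_mn];
    rewrite ler_norml => /andP[]; have := p0 n; have := p0 m;
    by move: (_ ^+ n) (_ ^+ m) => *; lra.
have sup_a : has_sup (range a).
  by split; [exists (a 0%N), 0%N | exists (b 0%N) => _ [n _ <-]].
exists (sup (range a)) => n.
have h1 : a n <= sup (range a) by apply: ub_le_sup; [case: sup_a | exists n].
have h2 : sup (range a) <= b n.
  by apply: ge_sup; [case: sup_a | move=> _ [k _ <-]].
by rewrite ler_norml; move: h1 h2; rewrite /a /b => *; lra.
Qed.

Lemma nm_i : nm ('i%C : K) = 1.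
Proof.
by apply: complexI; rewrite -normE [LHS]normc_def /= expr0n /= add0r expr1n sqrtr1.
Qed.

Lemma nm_ReIm (z : K) : nm z <= `|complex.Re (z : R[i])| + `|complex.Im (z : R[i])|.
Proof.
have -> : nm z = nm ((((complex.Re (z : R[i]))%:C)%C : K) + ('i%C : R[i]) * ((complex.Im (z : R[i]))%:C)%C).
  by congr nm; exact: complexE.
by apply: le_trans (nmD _ _) _; rewrite nmM !nm_real nm_i mul1r.
Qed.

Lemma Re_le_nm (z : K) : `|complex.Re (z : R[i])| <= nm z.
Proof.
by rewrite -lecR -normE; exact: normc_ge_Re.
Qed.

Lemma Im_le_nm (z : K) : `|complex.Im (z : R[i])| <= nm z.
Proof.
have := Re_le_nm (('i%C : R[i]) * z); rewrite nmM nm_i.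
by case: (z : R[i]) => a b /=; rewrite mul1r mul0r mul1r sub0r normrN.
Qed.

Lemma cplx_geo_complete : geo_complete (K : normedZmodType K).
Proof.
move=> u C h.
have [|a ha] := @real_geo_complete (fun n => complex.Re (u n : R[i])) C.
  move=> n; apply: le_trans (h n); apply: le_trans (Re_le_nm _).
  by case: (u n : R[i]) (u n.+1 : R[i]) => [? ?] [? ?] /=.
have [|b hb] := @real_geo_complete (fun n => complex.Im (u n : R[i])) C.
  move=> n; apply: le_trans (h n); apply: le_trans (Im_le_nm _).
  by case: (u n : R[i]) (u n.+1 : R[i]) => [? ?] [? ?] /=.
exists (a +i* b)%C => n; apply: le_trans (nm_ReIm _) _.
have := lerD (ha n) (hb n); rewrite -!mulrDl -natrD.
by case: (u n : R[i]) => [? ?] /=.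
Qed.

(** The iterates of [z |-> y + Q z] from [0] have steps that halve each time. *)
Lemma neumann (V : completeNormedModType K) (Q : V -> V) :
  (forall x y, Q (x - y) = Q x - Q y) -> (forall y, nm (Q y) <= 2^-1 * nm y) ->
  forall y, exists z, z = y + Q z.
Proof.
move=> QB Qh y.
pose u := fix u n := if n is k.+1 then y + Q (u k) else 0.
have [|l hl] := @banach_geo_complete V u (nm y).
  elim=> [|n ih].
    rewrite /= subr0 expr0 mulr1 -{1}(subrr 0) QB subrr addr0; exact: lexx.
  rewrite [u n.+2]/= [in X in _ - X]/= opprD addrACA subrr add0r -QB.
  apply: le_trans (Qh _) _; rewrite exprS mulrCA; apply: ler_wpM2l => //.
exists l; apply/eqP; rewrite -subr_eq0; apply/eqP.
apply: (@nm_halfX_eq0 _ _ (8 * nm y)) => n.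
rewrite (_ : l - _ = (l - u n.+1) + Q (u n - l)); last first.
  by rewrite QB /= !opprD !addrA subrK.
apply: le_trans (nmD _ _) _.
have h1 := hl n.+1; have h2 := hl n; have h3 := Qh (u n - l).
rewrite nmBC in h2; rewrite exprS in h1.
have h4 : 0 <= nm y * 2^-1 ^+ n by rewrite mulr_ge0 ?nm_ge0// ltW// halfX_gt0.
by move: h1 h2 h3 h4; move: (_ ^+ n) => *; nra.
Qed.

End Completeness.

(** * Zabreiko's lemma *)

Section Gauge.
Context {R : realType}.
Local Notation K := (Cplx R).
(** The relation [P y M] reads: the element [y] has cost at most [M].  It stands for a
    seminorm given as an infimum, whose value need not be attained. *)
Variables (Y : completeNormedModType K) (P : Y -> R -> Prop).
Hypothesis P_mono : forall y M M', P y M -> M <= M' -> P y M'.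
Hypothesis PB : forall y y' M M', P y M -> P y' M' -> P (y - y') (M + M').
Hypothesis PZ : forall a y M, P y M -> P (a *: y) (nm a * M).
Hypothesis P_ex : forall y, exists M, P y M.
(** Countable subadditivity: [r k] is the remainder of a series with sum [r 0]. *)
Hypothesis P_series : forall (r : nat -> Y) (M N : R),
  (forall k, P (r k - r k.+1) (M * 2^-1 ^+ k)) ->
  (forall k, nm (r k) <= N * 2^-1 ^+ k) -> P (r 0%N) (4 * M).

(** One step of Baire's argument, for the sets of elements of cost at most [k].  The
    radius is halved to make the centres converge and the closed balls nested. *)
Let baire_step : ~ (exists k : nat, exists y0 : Y, exists2 r : R, 0 < r &
    forall y, nm (y - y0) < r -> forall e, 0 < e -> exists2 y', P y' k%:R & nm (y - y') < e) ->
  forall a : nat * (Y * R), exists b : Y * R, 0 < a.2.2 ->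
    [/\ 0 < b.2, b.2 <= a.2.2 / 2, nm (b.1 - a.2.1) <= a.2.2 / 2 &
        forall z, nm (z - b.1) <= b.2 -> ~ P z a.1%:R].
Proof.
move=> H [k [y0 r]] /=; apply: contrapT => nb; apply: H.
have r0 : 0 < r by apply: contrapT => r0; apply: nb; exists (0, 0).
exists k, y0, (r / 2) => [|y hy e e0]; first by rewrite divr_gt0.
apply: contrapT => ny; apply: nb; exists (y, Num.min (e / 2) (r / 2)) => _ /=.
have m1 : Num.min (e / 2) (r / 2) <= e / 2 by rewrite ge_min lexx.
split => //; first by rewrite lt_min !divr_gt0.
- by rewrite ge_min lexx orbT.
- exact: ltW.
- move=> z hz Pz; apply: ny; exists z => //; rewrite nmBC.
  by apply: le_lt_trans (le_trans hz m1) _; lra.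
Qed.

(** Otherwise the limit of shrinking balls, the [k]-th of which avoids cost [k], would
    have no finite cost. *)
Let gauge_baire : exists k : nat, exists y0 : Y, exists2 r : R, 0 < r &
  forall y, nm (y - y0) < r -> forall e, 0 < e ->
    exists2 y', P y' k%:R & nm (y - y') < e.
Proof.
apply: contrapT => /baire_step /choice[f hf].
pose s := fix s n := if n is k.+1 then f (k, s k) else (0 : Y, 1 : R).
have s0 n : 0 < (s n).2 by elim: n => [|n ih] //=; have [] := hf (n, s n) ih.
have hs n := hf (n, s n) (s0 n).
have sle n : (s n).2 <= 2^-1 ^+ n.
  elim: n => [|n ih]; first by rewrite expr0.
  have [_ h _ _] := hs n; apply: le_trans h _; rewrite exprSr.
  by rewrite ler_wpM2r.
have [|l hl] := @banach_geo_complete _ Y (fun n => (s n).1) 2^-1.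
  move=> n; have [_ _ h _] := hs n; apply: le_trans h _ => /=.
  by rewrite mulrC ler_wpM2l.
have nested n k : nm ((s (n + k)%N).1 - (s n).1) + (s (n + k)%N).2 <= (s n).2.
  elim: k => [|k ih]; first by rewrite addn0 subrr nm0 add0r.
  rewrite addnS; have [_ h1 h2 _] := hs (n + k)%N; rewrite /= in h1 h2.
  have h3 := nmD ((f ((n + k)%N, s (n + k)%N)).1 - (s (n + k)%N).1)
    ((s (n + k)%N).1 - (s n).1).
  rewrite subrKA in h3; rewrite /=.
  by move: h1 h2 h3 ih; set a := nm _; set b := nm _; set c := nm _; lra.
have hl2 n : nm (l - (s n).1) <= (s n).2.
  rewrite -subr_le0; apply: (@le_halfX_le0 _ _ 2) => k.
  have h1 := hl (n + k)%N; have h2 := nested n k; have h3 := s0 (n + k)%N.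
  have h4 := nmD (l - (s (n + k)%N).1) ((s (n + k)%N).1 - (s n).1).
  rewrite subrKA in h4.
  have h5 : 4 * 2^-1 * 2^-1 ^+ (n + k) <= (2 : R) * 2^-1 ^+ k.
    rewrite exprD (_ : 4 * 2^-1 = 2 :> R); last by lra.
    have q1 : (2^-1 : R) ^+ n <= 1 by apply: exprn_ile1 => //; rewrite invf_le1// ler1n.
    by have := ler_wpM2r (ltW (halfX_gt0 k)) q1; rewrite mul1r; lra.
  by move: h1 h2 h3 h4 h5; set a := nm _; set b := nm _; set c := nm _; set d := _ ^+ (n + k); lra.
have [M hM] := P_ex l.
pose k := (Num.truncn M).+1.
have [_ _ _ /(_ l (hl2 k.+1))] := hs k; apply => /=.
by apply: P_mono hM _; exact/ltW/truncnS_gt.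
Qed.

(** The Baire argument provides approximations of bounded cost in a ball; they are
    moved to the origin by a difference, rescaled, and applied again to the error.
    The errors halve each time, so the costs form a convergent series. *)
Lemma gauge_bounded : exists2 C : R, 0 <= C & forall y, P y (C * nm y).
Proof.
have [k [y0 [r r0 h]]] := gauge_baire.
have h0 y e : nm y < r -> 0 < e -> exists2 y', P y' (k%:R + k%:R) & nm (y - y') < e.
  move=> hy e0; have e2 : 0 < e / 2 by rewrite divr_gt0.
  have [|a Pa ha] := h (y0 + y) _ _ e2; first by rewrite addrC addKr.
  have [|b Pb hb] := h y0 _ _ e2; first by rewrite subrr nm0.
  exists (a - b); first exact: PB.
  rewrite (_ : y - _ = (y0 + y - a) - (y0 - b)).
    by apply: le_lt_trans (nmD _ _) _; rewrite nmN; lra.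
  by rewrite !opprB [RHS]addrC -[y0 + y - a]addrA subrKA addrCA.
(* An element of norm [r / 2] is approximated up to [r / 4] at cost [2 k]. *)
pose C := 4 * k%:R / r.
have C0 : 0 <= C by rewrite divr_ge0 ?(ltW r0)// mulr_ge0.
have h1 y : exists y', P y' (C * nm y) /\ nm (y - y') <= 2^-1 * nm y.
  have [->|/nm_gt0 y0'] := eqVneq y 0.
    have [M hM] := P_ex 0; exists 0; have := PZ 0 hM.
    by rewrite scaler0 subr0 !nm0 mul0r !mulr0.
  pose t := r / (2 * nm y); have t0 : 0 < t by rewrite divr_gt0// mulr_gt0.
  pose a : K := (t%:C)%C.
  have na : nm a = t by rewrite nm_real gtr0_norm.
  have a0 : a != 0 by apply: contraTneq t0 => a0; rewrite -na a0 nm0 ltxx.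
  have tE : t * nm y = r / 2 by rewrite /t; field; rewrite gt_eqF.
  have [||y' Py' hy'] := h0 (a *: y) (r / 4).
  - by rewrite nmZ na tE; lra.
  - by rewrite divr_gt0.
  exists (a^-1 *: y'); split.
    apply: P_mono (PZ a^-1 Py') _; rewrite nmV na /t /C.
    rewrite le_eqVlt; apply/orP; left; apply/eqP; field; lra.
  rewrite -[y in y - _](scalerK a0) -scalerBr nmZ nmV na.
  rewrite ler_pdivrMl// mulrCA tE; apply: le_trans (ltW hy') _; lra.
have [g hg] := choice h1.
exists (4 * C) => [|y]; first by rewrite mulr_ge0.
pose u := fix u n := if n is m.+1 then u m - g (u m) else y.
have hu n : nm (u n) <= nm y * 2^-1 ^+ n.
  elim: n => [|n ih]; first by rewrite expr0 mulr1.
  have [_ h2] := hg (u n); apply: le_trans h2 _.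
  by rewrite exprS mulrCA ler_wpM2l.
rewrite -mulrA; apply: (@P_series u _ (nm y)) => // n.
rewrite /= opprB addrC subrK; have [h2 _] := hg (u n).
apply: P_mono h2 _; rewrite -mulrA; exact: ler_wpM2l.
Qed.

End Gauge.

(** * The Hahn-Banach theorem *)

Section HahnBanach.
Context {R : realType}.
Local Notation K := (Cplx R).
Variable X : normedModType K.

Local Notation "t *~: x" := (((t%:C)%C : K) *: x) (at level 40).

Definition sublinear (p : X -> R) :=
  (forall x y, p (x + y) <= p x + p y) /\
  (forall (t : R) x, 0 <= t -> p (t *~: x) = t * p x).

Lemma rscaleA (s t : R) (x : X) : s *~: (t *~: x) = (s * t) *~: x.
Proof. by rewrite scalerA; congr (_ *: x); rewrite rmorphM. Qed.
Lemma rscaleD (s t : R) (x : X) : (s + t) *~: x = s *~: x + t *~: x.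
Proof. by rewrite -scalerDl; congr (_ *: x); rewrite rmorphD. Qed.
Lemma rscale1 (x : X) : 1 *~: x = x.
Proof. by rewrite (_ : ((1%:C)%C : K) = 1) ?scale1r. Qed.
Lemma rscale0 (x : X) : 0 *~: x = 0.
Proof. by rewrite (_ : ((0%:C)%C : K) = 0) ?scale0r. Qed.

Lemma sublinear0 p : sublinear p -> p 0 = 0.
Proof. by move=> [_ /(_ 0 0 (lexx _))]; rewrite rscale0 mul0r. Qed.

Lemma sublinear_lb p q x : sublinear p -> sublinear q -> (forall y, q y <= p y) ->
  - p (- x) <= q x.
Proof.
move=> hp hq le; have := hq.1 x (- x); rewrite subrr (sublinear0 hq).
by have := le (- x); lra.
Qed.

(** A minorant of [p] that is additive along [v] and agrees with [p] at [v] satisfies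
    all the inequalities whose infimum is taken here. *)
Definition push (p : X -> R) (v x : X) : R :=
  inf [set p (x + t *~: v) - t * p v | t in [set t : R | 0 <= t]].

Let pset (p : X -> R) (v x : X) : set R := [set p (x + t *~: v) - t * p v | t in [set t : R | 0 <= t]].

Lemma push_lb p v x : sublinear p -> lbound (pset p v x) (- p (- x)).
Proof.
move=> hp _ [t /= t0 <-].
have := hp.1 (- x) (x + t *~: v); rewrite addKr hp.2//; lra.
Qed.

Lemma push_le p v x t : sublinear p -> 0 <= t -> push p v x <= p (x + t *~: v) - t * p v.
Proof.
move=> hp t0; apply: ge_inf; last by exists t.
by exists (- p (- x)); exact: push_lb.
Qed.

Lemma push_ge p v x (b : R) : (forall t : R, 0 <= t -> b <= p (x + t *~: v) - t * p v) ->
  b <= push p v x.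
Proof.
move=> h; apply: lb_le_inf; last by move=> _ [t /= t0 <-]; exact: h.
by exists (p (x + 0 *~: v) - 0 * p v), 0 => /=.
Qed.

(** The infimum over [t] of one translate and the infimum over [s] of another combine
    into the translate by [s + t]. *)
Lemma push_sublinear p v : sublinear p -> sublinear (push p v).
Proof.
move=> hp; split.
- move=> x y.
  suff h s : 0 <= s -> push p v (x + y) - (p (x + s *~: v) - s * p v) <= push p v y.
    have : push p v (x + y) - push p v y <= push p v x.
      by apply: push_ge => s /h; lra.
    lra.
  move=> s0; apply: push_ge => t t0.
  have := @push_le p v (x + y) (s + t) hp (addr_ge0 s0 t0).
  have := hp.1 (x + s *~: v) (y + t *~: v).
  rewrite addrACA -rscaleD; lra.
- move=> t x; rewrite le_eqVlt => /predU1P[<-|t0].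
    rewrite rscale0 mul0r; apply/le_anti/andP; split.
      have := @push_le p v 0 0 hp (lexx _).
      by rewrite rscale0 addr0 (sublinear0 hp) mul0r subr0.
    by apply: push_ge => s s0; rewrite add0r hp.2// subrr.
  apply/le_anti/andP; split.
    rewrite -ler_pdivrMl//; apply: push_ge => s s0; rewrite ler_pdivrMl//.
    apply: le_trans (@push_le p v _ (t * s) hp (mulr_ge0 (ltW t0) s0)) _.
    rewrite -rscaleA -scalerDr hp.2 ?(ltW t0)//. lra.
  apply: push_ge => s s0.
  have := @push_le p v x (t^-1 * s) hp (mulr_ge0 (ltW (_ : 0 < t^-1)) s0).
  have hE := hp.2 t (x + (t^-1 * s) *~: v) (ltW t0).
  rewrite invr_gt0 => /(_ t0); rewrite -(ler_pM2l t0) => /le_trans; apply.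
  rewrite mulrBr -hE scalerDr rscaleA !mulrA divff ?gt_eqF// !mul1r.
  exact: lexx.
Qed.

Lemma push_le_self p v x : sublinear p -> push p v x <= p x.
Proof.
by move=> hp; have := @push_le p v x 0 hp (lexx _); rewrite rscale0 addr0 mul0r subr0.
Qed.

(** A chain has its pointwise infimum as a lower bound; it is finite because
    [- p (- x)] bounds every sublinear minorant of [p] from below. *)
Lemma minimal_sublinear p : sublinear p -> exists q, [/\ sublinear q,
  (forall x, q x <= p x) &
  forall q', sublinear q' -> (forall x, q' x <= q x) -> q' = q].
Proof.
move=> hp.
pose T := {q : X -> R | sublinear q /\ forall x, q x <= p x}.
pose le (a b : T) := `[< forall x, sval b x <= sval a x >].
have [||||[q [hq hqp]] hmin] := @Zorn T le.
- by move=> t; apply/asboolP.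
- move=> r s t /asboolP h1 /asboolP h2; apply/asboolP => x.
  exact: le_trans (h2 x) (h1 x).
- move=> [s hs] [t ht] /asboolP /= h1 /asboolP /= h2; apply: eq_exist => /=.
  by apply/funext => x; apply/le_anti; rewrite h1 h2.
- move=> A totA.
  have [[a0 Aa0]|nA] := pselect (exists a, A a); last first.
    exists (exist _ p (conj hp (fun x => lexx _))) => s As.
    by exfalso; apply: nA; exists s.
  pose S x := [set sval a x | a in A].
  have Slb x : lbound (S x) (- p (- x)).
    by move=> _ [[a [ha hap]] _ <-] /=; exact: sublinear_lb.
  pose m x := inf (S x).
  have mle a x : A a -> m x <= sval a x.
    move=> Aa; apply: ge_inf; [by exists (- p (- x)) | by exists a].
  have mge x b : (forall a, A a -> b <= sval a x) -> b <= m x.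
    move=> h; apply: lb_le_inf; first by exists (sval a0 x), a0.
    by move=> _ [a Aa <-]; exact: h.
  have hm : sublinear m.
    split.
    - move=> x y.
      suff h a : A a -> m (x + y) - sval a x <= m y.
        have : m (x + y) - m y <= m x by apply: mge => a /h; lra.
        lra.
      move=> Aa; apply: mge => b Ab.
      have [c [Ac hca hcb]] : exists c, [/\ A c, (forall x, sval c x <= sval a x) &
         (forall x, sval c x <= sval b x)].
        by have [/asboolP h|/asboolP h] := totA a b Aa Ab; [exists b|exists a].
      have := mle c (x + y) Ac; have := (svalP c).1.1 x y.
      by have := hca x; have := hcb y; lra.
    - move=> t x; rewrite le_eqVlt => /predU1P[<-|t0].
        rewrite rscale0 mul0r; apply/le_anti/andP; split.
          by have := mle a0 0 Aa0; rewrite (sublinear0 (svalP a0).1).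
        by apply: mge => a Aa; rewrite (sublinear0 (svalP a).1).
      have hE (a : T) : sval a (t *~: x) = t * sval a x.
        by have [[_ ->] //] := svalP a; exact: ltW.
      apply/le_anti/andP; split.
        rewrite -ler_pdivrMl//; apply: mge => a Aa.
        by rewrite ler_pdivrMl// -hE; apply: mle.
      by apply: mge => a Aa; rewrite hE; apply: (ler_wpM2l (ltW t0)); apply: mle.
  have hmp x : m x <= p x by apply: le_trans (mle a0 x Aa0) _; exact: (svalP a0).2.
  by exists (exist _ m (conj hm hmp)) => s As; apply/asboolP => x /=; exact: mle.
exists q; split => // q' hq' h.
have hq'p x : q' x <= p x by exact: le_trans (h x) (hqp x).
by have /(congr1 sval) := hmin (exist _ q' (conj hq' hq'p)) (asboolT h).
Qed.

(** A minimal functional coincides with its push in every direction. *)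
Lemma minimal_sublinear_add q : sublinear q ->
  (forall q', sublinear q' -> (forall x, q' x <= q x) -> q' = q) ->
  forall x y, q (x + y) = q x + q y.
Proof.
move=> hq hmin x v; apply/le_anti; rewrite hq.1 /=.
have E := hmin _ (push_sublinear v hq) (fun x => push_le_self v x hq).
have := @push_le q v x 1 hq ler01; rewrite E rscale1 mul1r; lra.
Qed.

(** Zorn's lemma is started from the norm pushed in the direction [e]: its value at
    [- e] is at most [- nm e], and this forces a positive value at [e] on every additive
    minorant. *)
Lemma real_hahn_banach (e : X) : e != 0 -> exists f : X -> R,
  [/\ forall x y, f (x + y) = f x + f y,
      forall t x, f (t *~: x) = t * f x,
      forall x, `|f x| <= nm x & 0 < f e].
Proof.
move=> e0.
have hp : sublinear (fun x : X => nm x).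
  by split => [x y|t x t0]; [exact: nmD | rewrite nmZ nm_real ger0_norm].
have [q [hq hle hmin]] := minimal_sublinear (push_sublinear e hp).
have qD := minimal_sublinear_add hq hmin.
have qN x : q (- x) = - q x.
  have := qD x (- x); rewrite subrr (sublinear0 hq); lra.
have qle x : q x <= nm x.
  by apply: le_trans (hle x) _; exact: push_le_self.
exists q; split => //.
- move=> t x; have [t0|t0] := leP 0 t; first exact: hq.2.
  have := hq.2 (- t) x; rewrite oppr_ge0 ltW// => /(_ isT).
  rewrite mulNr (_ : (- t) *~: x = - (t *~: x)); first by rewrite qN; lra.
  by rewrite -scaleNr; congr (_ *: x); rewrite rmorphN.
- move=> x; rewrite ler_norml qle andbT.
  by have := qle (- x); rewrite nmN qN; lra.
- have := hle (- e); have := @push_le _ e (- e) 1 hp ler01.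
  rewrite rscale1 addNr nm0 qN mul1r.
  by have := nm_gt0 e0; lra.
Qed.

(** The complex functional is [x |-> g x - i g (i x)] for a real-linear [g], divided by its
    value at [e]. *)
Lemma hahn_banach (e : X) : e != 0 -> exists f : X -> K,
  [/\ forall (a : K) x y, f (a *: x + y) = a * f x + f y,
      exists2 C : R, 0 <= C & forall x, nm (f x) <= C * nm x & f e = 1].
Proof.
move=> e0; have [g [gD gZ gle ge]] := real_hahn_banach e0.
pose i : K := 'i%C.
have gi (a b : R) x : g (((a +i* b)%C : K) *: x) = a * g x + b * g (i *: x).
  have -> : ((a +i* b)%C : K) = (a%:C)%C + (b%:C)%C * i.
    by apply/eqP; rewrite eq_complex /= !(mulr0, mulr1, mul0r, addr0, subr0, add0r, oppr0) !eqxx.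
  by rewrite scalerDl gD -scalerA !gZ.
pose f x : K := (g x -i* g (i *: x))%C.
have flin (a : K) x y : f (a *: x + y) = a * f x + f y.
  rewrite /f scalerDr scalerA !gD; case: a => a b.
  have -> : i * (a +i* b)%C = (- b +i* a)%C :> R[i].
    by apply/eqP; rewrite eq_complex /= !(mulr0, mulr1, mul0r, mul1r, addr0, subr0, add0r, sub0r) !eqxx.
  rewrite (gi a b) (gi (- b) a); apply/eqP; rewrite eq_complex /=.
  by apply/andP; split; apply/eqP; ring.
have fe : f e != 0.
  by rewrite eq_complex /= negb_and gt_eqF.
exists (fun x => (f e)^-1 * f x); split.
- by move=> a x y; rewrite flin mulrDr mulrCA.
- exists ((nm (f e))^-1 * 2) => [|x]; first by rewrite mulr_ge0 // invr_ge0 nm_ge0.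
  rewrite nmM nmV -mulrA ler_wpM2l// ?invr_ge0 ?nm_ge0//.
  apply: le_trans (nm_ReIm _) _; rewrite /= normrN.
  have h1 := gle x; have := gle (i *: x); rewrite nmZ nm_i; lra.
- by rewrite mulVf.
Qed.

End HahnBanach.

(** * Topology of the complex plane *)

Section Topology.
Context {R : realType}.
Local Notation K := (Cplx R).

Lemma open_locally (P : K -> Prop) :
  open [set l : K | exists2 r : R, 0 < r & forall l', nm (l' - l) < r -> P l'].
Proof.
rewrite openE => l [r r0 h]; apply/nbhs_nm; exists (r / 2); first by rewrite divr_gt0.
move=> l1 h1; exists (r / 2) => [|l2 h2]; first by rewrite divr_gt0.
apply: h; rewrite -(subrKA l1 l2 (- l)).
by apply: le_lt_trans (nmD _ _) _; rewrite (nmBC l1 l); lra.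
Qed.

Lemma openP_nm (A : set K) (l : K) : open A -> A l ->
  exists2 r : R, 0 < r & forall l', nm (l' - l) < r -> A l'.
Proof.
rewrite openE => h /h /nbhs_nm[r r0 hr]; exists r => // l' h'; apply: hr.
by rewrite nmBC.
Qed.

(** The sets where [P] and [~ P] hold locally are open and partition [Om]. *)
Lemma connected_locally_constant (Om : set K) (P : K -> Prop) : connected Om ->
  (forall l0, Om l0 -> exists2 r : R, 0 < r &
     forall l, Om l -> nm (l - l0) < r -> (P l <-> P l0)) ->
  forall l1 l2, Om l1 -> Om l2 -> P l1 -> P l2.
Proof.
move=> conn loc l1 l2 O1 O2 P1.
pose C (Q : K -> Prop) :=
  [set l : K | exists2 r : R, 0 < r & forall l', nm (l' - l) < r -> Om l' -> Q l'].
have CE (Q : K -> Prop) : (forall l0, Om l0 -> exists2 r : R, 0 < r &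
     forall l, Om l -> nm (l - l0) < r -> (Q l <-> Q l0)) ->
     forall l, Om l -> (C Q l <-> Q l).
  move=> locQ l Ol; split => [[r r0 h]|Ql]; first by apply: h => //; rewrite subrr nm0.
  have [r r0 h] := locQ l Ol; exists r => // l' hl' Ol'; exact/h.
have : Om `&` C P = Om.
  apply: conn.
  - by exists l1; split => //; apply/CE.
  - by exists (C P) => //; exact: open_locally.
  - exists (~` (C (fun l => ~ P l))); first exact/open_closedC/open_locally.
    have locN : forall l0, Om l0 -> exists2 r : R, 0 < r &
       forall l, Om l -> nm (l - l0) < r -> (~ P l <-> ~ P l0).
      move=> l0 O0; have [r r0 h] := loc l0 O0; exists r => // l Ol hl.
      by have := h l Ol hl; tauto.
    apply/seteqP; split => l [Ol h]; split => //.
      by move/(CE _ locN _ Ol); apply; exact/(CE _ loc).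
    by apply/(CE _ loc) => //; apply: contrapT => /(CE _ locN _ Ol).
by move=> E; apply/(CE _ loc l2 O2); have : Om l2 by []; rewrite -{1}E => -[].
Qed.

(** The closure is contained in the image of a square under [(a, b) |-> a + i b]. *)
Lemma bounded_closure_compact (A : set K) : bounded_set A -> compact (closure A).
Proof.
move=> [M [Mr hM]].
pose m : R := complex.Re (M : R[i]) + 2.
have hA z : closure A z -> nm z <= m.
  have ME : M = ((complex.Re (M : R[i]))%:C)%C :> R[i].
    by have := RRe_real (Mr : (M : R[i]) \is Num.real).
  have nball : nbhs z [set y | nm (z - y) < 1] by apply/nbhs_nm; exists 1.
  move=> /(_ _ nball)[y [Ay /= zy]].
  have ym : nm y <= complex.Re (M : R[i]) + 1.
    rewrite -lecR -normE; apply: (hM (((complex.Re (M : R[i]) + 1)%:C)%C : K)) => //.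
    by rewrite ME ltcR ltrDl.
  by have := nmD (z - y) y; rewrite subrK /m; lra.
pose g (v : 'rV[R]_2) : K := (v 0 0 +i* v 0 1)%C.
have gc : continuous g.
  move=> v A0 /nbhs_nm[r r0 hr].
  have r2 : 0 < r / 2 by rewrite divr_gt0.
  have h0 := @coord_continuous R 1 2 0 0 v _ (nbhsx_ballx (v 0 0) _ r2).
  have h1 := @coord_continuous R 1 2 0 1 v _ (nbhsx_ballx (v 0 1) _ r2).
  apply: (@filterS2 _ _ (@nbhs_filter 'rV[R]_2 v) _ _ _ _ h0 h1) => w.
  rewrite /= /ball /= => {}h0 {}h1.
  by apply: hr; apply: le_lt_trans (nm_ReIm _) _ => /=; lra.
have cB : compact [set v : 'rV[R]_2 | forall i, v 0 i \in `[- m, m]].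
  by apply: (@rV_compact _ _ (fun=> `[- m, m]%classic)) => _; exact: segment_compact.
have cI : compact (g @` [set v : 'rV[R]_2 | forall i, v 0 i \in `[- m, m]]).
  by apply: continuous_compact cB; exact: continuous_subspaceT.
apply: subclosed_compact (@closed_closure _ A) cI _ => z Az /=.
exists (\row_j if j == 0 then complex.Re (z : R[i]) else complex.Im (z : R[i])).
  move=> j /=; rewrite mxE in_itv /= -ler_norml; apply: le_trans (hA z Az).
  by case: ifP => _; [exact: Re_le_nm | exact: Im_le_nm].
by rewrite /g !mxE /=; case: (z : R[i]).
Qed.

End Topology.

(** * Removing the zeros of a tuple *)

Section ZeroRemoval.
Context {R : realType}.
Local Notation K := (Cplx R).
(** Here [Bd v M] reads: [v] has size at most [M].  The cases of interest are a Banach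
    space with the ranges of a pencil for [Z], and the functionals on a Banach
    space with the annihilators of the null spaces for [Z]. *)
Variables (V : lmodType K) (Bd : V -> R -> Prop) (Om : set K) (Z : K -> V -> Prop).
Variable n : nat.
Hypothesis Bd_mono : forall v M M', Bd v M -> M <= M' -> Bd v M'.
Hypothesis Bd0 : Bd 0 0.
Hypothesis BdD : forall u v M M', Bd u M -> Bd v M' -> Bd (u + v) (M + M').
Hypothesis BdZ : forall a v M, Bd v M -> Bd (a *: v) (nm a * M).
Hypothesis ZZ : forall l a v, Om l -> Z l v -> Z l (a *: v).

(** Local data at [l0].  The map [q l] gives coordinates of [V / Z l] that are uniformly
    bounded for [l] near [l0] and continuous at [l0]; [L] divides elements of [Z l0] by
    [l - l0], simultaneously in all the quotients [V / Z l]. *)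
Record frame (l0 : K) (r C : R) (L : V -> V) (q : K -> V -> 'I_n -> K) : Prop := Frame {
  frame_r : 0 < r;
  frame_C : 0 <= C;
  frame_lin : forall l, nm (l - l0) < r ->
    forall a u v j, q l (a *: u + v) j = a * q l u j + q l v j;
  frame_ker : forall l, nm (l - l0) < r ->
    forall v M, Bd v M -> (Z l v <-> forall j, q l v j = 0);
  frame_bnd : forall l, nm (l - l0) < r ->
    forall v (M : R) j, 0 <= M -> Bd v M -> nm (q l v j) <= C * M;
  frame_cont : forall l, nm (l - l0) < r ->
    forall v (M : R) j, 0 <= M -> Bd v M -> nm (q l v j - q l0 v j) <= C * M * nm (l - l0);
  frame_div : forall v M, Bd v M -> Z l0 v ->
    Bd (L v) (C * M) /\ forall l, Om l -> Z l (v - (l - l0) *: L v) }.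

Hypothesis frames : forall l0, Om l0 -> exists r C L q, frame l0 r C L q.

Implicit Types v : 'I_n -> V.

Definition bounded_tuple v := exists2 M, 0 <= M & forall i, Bd (v i) M.
(** The classes of the [v i] in [V / Z l] are linearly independent. *)
Definition regular (l : K) v :=
  forall c : 'I_n -> K, Z l (\sum_i c i *: v i) -> forall i, c i = 0.

Definition coord_mx (q : V -> 'I_n -> K) v : 'M[K]_n := \matrix_(i, j) q (v i) j.

Lemma Bd_sum v M (c : 'I_n -> K) : (forall i, Bd (v i) M) ->
  Bd (\sum_i c i *: v i) (\sum_i nm (c i) * M).
Proof.
move=> h; elim/big_ind2 : _ => [|u M1 w M2 h1 h2|i _].
- exact: Bd0.
- exact: BdD.
- exact: BdZ.
Qed.

Definition coord_linear (q : V -> 'I_n -> K) :=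
  forall a u w j, q (a *: u + w) j = a * q u j + q w j.

Lemma coord_comb q v c j : coord_linear q ->
  q (\sum_i c i *: v i) j = ((\row_i c i) *m coord_mx q v) 0 j.
Proof.
move=> hq; have q0 k : q 0 k = 0.
  by have := hq (- 1) 0 0 k; rewrite scaler0 addr0 mulN1r addNr.
have qS (s : seq 'I_n) : q (\sum_(i <- s) c i *: v i) j = \sum_(i <- s) c i * q (v i) j.
  by elim: s => [|i s ih]; rewrite ?big_nil ?q0// !big_cons hq ih.
by rewrite qS mxE; apply: eq_bigr => i _; rewrite !mxE.
Qed.

(** The coordinates [q] turn the combination with coefficients [c] into [c] times the
    matrix, and a square matrix has a nonzero left kernel exactly if it is singular. *)
Lemma regular_det l q v : coord_linear q -> (forall u M, Bd u M -> (Z l u <-> forall j, q u j = 0)) ->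
  bounded_tuple v -> regular l v <-> \det (coord_mx q v) != 0.
Proof.
move=> hq ker [M M0 hv].
have zE c : Z l (\sum_i c i *: v i) <-> (\row_i c i) *m coord_mx q v = 0.
  rewrite (ker _ _ (Bd_sum c hv)); split => [h|h j].
    by apply/rowP => j; rewrite -coord_comb// h mxE.
  by rewrite coord_comb// h mxE.
split => [reg|d0 c /zE h i].
  apply/negP => /det0P[w w0 hw].
  have := reg (fun i => w 0 i); rewrite zE.
  have -> : \row_i w 0 i = w by apply/rowP => i; rewrite mxE.
  move=> /(_ hw) h; move/negP: w0; apply; apply/eqP/rowP => i; rewrite h mxE//.
have : \row_i c i == 0.
  apply: contraNT d0 => c0; apply/det0P; by exists (\row_i c i).
by move=> /eqP/rowP/(_ i); rewrite !mxE.
Qed.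

(** [A] and [B] have the same cofactors along row [i0], and these are orthogonal to all rows
    of [A] but that one. *)
Lemma det_row_comb (A B : 'M[K]_n) (d : 'I_n -> K) i0 : d i0 = 1 ->
  (forall j, B i0 j = \sum_i d i * A i j) -> (forall i j, i != i0 -> B i j = A i j) ->
  \det B = \det A.
Proof.
move=> d1 hB hA.
have cof j : cofactor B i0 j = cofactor A i0 j.
  rewrite /cofactor; congr (_ * \det _); apply/matrixP => a b; rewrite !mxE hA//.
  by rewrite eq_sym neq_lift.
rewrite (expand_det_row _ i0).
under eq_bigr => j _ do rewrite hB cof mulr_suml.
rewrite exchange_big /=.
under eq_bigr => i _.
  under eq_bigr => j _ do rewrite -mulrA.
  rewrite -mulr_sumr.
  have -> : \sum_j A i j * cofactor A i0 j = (A *m \adj A) i i0.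
    by rewrite mxE; apply: eq_bigr => j _; rewrite !mxE.
  rewrite mul_mx_adj mxE.
  over.
rewrite (bigD1 i0)//= d1 eqxx mulr1n mul1r big1 ?addr0// => i /negPf ->.
by rewrite mulr0n mulr0.
Qed.

Lemma det_row_scale (A B : 'M[K]_n) (t : K) i0 :
  (forall j, B i0 j = t * A i0 j) -> (forall i j, i != i0 -> B i j = A i j) ->
  \det B = t * \det A.
Proof.
move=> h1 h2; rewrite (@determinant_multilinear _ _ B A A i0 t 0) ?mul0r ?addr0//.
- by apply/rowP => j; rewrite !mxE h1 mul0r addr0.
- by apply/matrixP => a b; rewrite !mxE h2// eq_sym neq_lift.
- by apply/matrixP => a b; rewrite !mxE h2// eq_sym neq_lift.
Qed.

(** The factorisation is stated for all coordinates [q] of all quotients, so that one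
    replacement of [v] can be read both near [l0] and at any other point. *)
Definition det_factor l0 k v v' := forall l (q : V -> 'I_n -> K), Om l -> coord_linear q ->
  (forall u M, Bd u M -> Z l u -> forall j, q u j = 0) ->
  \det (coord_mx q v) = (l - l0) ^+ k * \det (coord_mx q v').

(** The coefficients of the dependence are divided by the largest one.  This keeps the
    determinant, since the replaced row has coefficient 1, and it bounds the growth of the
    tuple by a factor that does not depend on [v]. *)
Lemma remove_zero l0 r C L q v M : Om l0 -> frame l0 r C L q -> 0 <= M ->
  (forall i, Bd (v i) M) -> ~ regular l0 v ->
  exists2 v', forall i, Bd (v' i) ((1 + C * n%:R) * M) & det_factor l0 1 v v'.
Proof.
move=> O0 fr M0 hv /existsNP[c /not_implyP[Zc /existsNP[i1 ci1]]].
have [i0 hi0] : exists i0, forall i, nm (c i) <= nm (c i0).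
  case: (@Order.TotalTheory.arg_maxP _ _ _ i1 xpredT (fun i => nm (c i)) isT) => i0 _ h.
  by exists i0 => i; exact: h.
have c0 : c i0 != 0.
  apply/eqP => c0; apply: ci1; apply: nm_eq0; apply/le_anti; rewrite nm_ge0 andbT.
  by rewrite -(nm0 (K : normedZmodType K)) -c0.
pose d i := (c i0)^-1 * c i.
have d1 : d i0 = 1 by rewrite /d mulVf.
have dle i : nm (d i) <= 1.
  by rewrite nmM nmV ler_pdivrMl ?nm_gt0// mulr1.
pose u := \sum_i d i *: v i.
have Zu : Z l0 u.
  rewrite /u; under eq_bigr => i _ do rewrite -scalerA.
  by rewrite -scaler_sumr; exact: ZZ.
have Bu : Bd u (n%:R * M).
  apply: Bd_mono (Bd_sum d hv) _; rewrite -mulr_suml ler_wpM2r//.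
  by rewrite -[n in leRHS]card_ord -sumr_const; apply: ler_sum.
have [BL ZL] := frame_div fr Bu Zu.
have nM : 0 <= n%:R * M by rewrite mulr_ge0.
have CnM : 0 <= C * (n%:R * M) by rewrite mulr_ge0// (frame_C fr).
exists (fun i => if i == i0 then L u else v i).
  move=> i; case: eqP => _; [apply: Bd_mono BL _ | apply: Bd_mono (hv i) _];
    rewrite mulrDl mul1r -mulrA; lra.
move=> l q' Ol hq ker; rewrite expr1.
pose B : 'M[K]_n := \matrix_(i, j) if i == i0 then q' u j else q' (v i) j.
rewrite -(@det_row_comb (coord_mx q' v) B d i0 d1).
- apply: (@det_row_scale _ _ _ i0).
  + move=> j; rewrite !mxE eqxx; apply/eqP; rewrite -subr_eq0; apply/eqP.
    have E : u - (l - l0) *: L u = (- (l - l0)) *: L u + u by rewrite scaleNr addrC.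
    have Bw : Bd (u - (l - l0) *: L u) (nm (- (l - l0)) * (C * (n%:R * M)) + n%:R * M).
      by rewrite E; apply: BdD Bu; exact: BdZ BL.
    by have := ker _ _ Bw (ZL l Ol) j; rewrite E hq mulNr addrC.
  + by move=> i j /negPf i0n; rewrite !mxE i0n.
- move=> j; rewrite mxE eqxx /u coord_comb// mxE.
  by apply: eq_bigr => i _; rewrite mxE.
- by move=> i j /negPf i0n; rewrite !mxE i0n.
Qed.

Lemma nm_prod (I : finType) (F : I -> K) : nm (\prod_i F i) = \prod_i nm (F i).
Proof. by elim/big_ind2 : _ => //; [exact: nm1|move=> a b c d <- <-; exact: nmM]. Qed.

Lemma det_bound (A : 'M[K]_n) (b : R) : (forall i j, nm (A i j) <= b) ->
  nm (\det A) <= #|{: 'S_n}|%:R * b ^+ n.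
Proof.
move=> h; apply: le_trans (nm_sum _) _.
rewrite -[in leRHS]sumr_const mulr_suml; apply: ler_sum => s _.
rewrite nmM nm_prod nmX nmN nm1 expr1n !mul1r.
rewrite -[n in leRHS]card_ord -prodr_const; apply: ler_prod => i _.
by rewrite nm_ge0 h.
Qed.

Lemma frame_coord_linear l0 r C L q l : frame l0 r C L q -> nm (l - l0) < r -> coord_linear (q l).
Proof. by move=> fr /(frame_lin fr). Qed.

Lemma det_factor_regular l0 v v' l k : Om l -> l != l0 -> bounded_tuple v -> bounded_tuple v' ->
  det_factor l0 k v v' -> (regular l v' <-> regular l v).
Proof.
move=> Ol ll0 bv bv' dv; have [r [C [L [q fr]]]] := frames Ol.
have hl : nm (l - l) < r by rewrite subrr nm0 (frame_r fr).
have ql := frame_coord_linear fr hl; have kl := frame_ker fr hl.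
rewrite (regular_det ql kl bv) (regular_det ql kl bv') (dv l _ Ol ql).
  by rewrite mulf_eq0 expf_eq0 subr_eq0 (negPf ll0) andbF.
by move=> u M /kl h /h.
Qed.

(** If the division by [l - l0] can be repeated for ever, the [k]-th tuple has size at most
    [A ^ k M], so the determinant at [l] is at most [N (A ^ n |l - l0|) ^ k].  It vanishes
    where [A ^ n |l - l0| <= 1 / 2]. *)
Lemma zero_dichotomy l0 v : Om l0 -> bounded_tuple v ->
  (exists2 rho : R, 0 < rho & forall l, Om l -> nm (l - l0) < rho -> ~ regular l v) \/
  (exists v', [/\ bounded_tuple v', regular l0 v' &
     forall l, Om l -> l != l0 -> (regular l v' <-> regular l v)]).
Proof.
move=> O0 bv; have [M M0 hv] := bv.
apply: contrapT => /not_orP[no1 no2]; apply: no1.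
have [r [C [L [q fr]]]] := frames O0.
have C0 := frame_C fr.
pose A := 1 + C * n%:R.
have A1 : 1 <= A by rewrite lerDl mulr_ge0.
have A0 : 0 < A by exact: lt_le_trans A1.
have chain k : exists2 vk, forall i, Bd (vk i) (A ^+ k * M) & det_factor l0 k v vk.
  elim: k => [|k [vk bk dk]].
    exists v; first by move=> i; rewrite expr0 mul1r.
    by move=> l q' _ _ _; rewrite expr0 mul1r.
  have AM0 : 0 <= A ^+ k * M by rewrite mulr_ge0// exprn_ge0// ltW.
  have nreg : ~ regular l0 vk.
    move=> reg; apply: no2; exists vk; split => //; first by exists (A ^+ k * M).
    move=> l Ol ll0; apply: det_factor_regular dk => //; by exists (A ^+ k * M).
  have [v' bv' dv'] := remove_zero O0 fr AM0 bk nreg.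
  exists v'; first by move=> i; rewrite exprS -mulrA; exact: bv'.
  by move=> l q' Ol hq ker; rewrite (dk l q')// (dv' l q')// expr1 mulrA exprSr.
pose B := A ^+ n.
have B0 : 0 < B by rewrite exprn_gt0.
exists (Num.min r (2 * B)^-1).
  by rewrite lt_min (frame_r fr) invr_gt0 mulr_gt0.
move=> l Ol; rewrite lt_min => /andP[lr lB].
have ql := frame_coord_linear fr lr; have kl := frame_ker fr lr.
rewrite (regular_det ql kl bv); apply/negP; rewrite negbK; apply/eqP.
pose N := #|{: 'S_n}|%:R * (C * M) ^+ n.
apply: (@nm_halfX_eq0 _ _ _ N) => k.
have [vk bk dk] := chain k.
rewrite (dk l (q l))//; last by move=> u M' /kl h /h.
have AM0 : 0 <= A ^+ k * M by rewrite mulr_ge0// exprn_ge0// ltW.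
rewrite nmM nmX.
have h1 : nm (\det (coord_mx (q l) vk)) <= N * B ^+ k.
  have -> : N * B ^+ k = #|{: 'S_n}|%:R * (C * (A ^+ k * M)) ^+ n.
    by rewrite /N /B -exprM mulnC exprM -mulrA -exprMn -mulrA [M * _]mulrC.
  apply: det_bound => i j; rewrite mxE; exact: (frame_bnd fr).
apply: le_trans (ler_wpM2l (exprn_ge0 _ (nm_ge0 _)) h1) _.
rewrite mulrCA -exprMn ler_wpM2l//.
  by rewrite mulr_ge0// exprn_ge0// mulr_ge0.
have hB : nm (l - l0) * B <= 2^-1.
  by rewrite -ler_pdivlMr// -invfM ltW.
by apply: lerXn2r hB; rewrite nnegrE ?mulr_ge0 ?nm_ge0// ltW.
Qed.

(** If [c] is in the left kernel of the matrix [B] at [l], then [c = c (A - B) A^-1] for the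
    matrix [A] at [l0], and the factor [(A - B) A^-1] is small. *)
Lemma regular_near l0 v : Om l0 -> bounded_tuple v -> regular l0 v ->
  exists2 rho : R, 0 < rho & forall l, Om l -> nm (l - l0) < rho -> regular l v.
Proof.
move=> O0 bv; have [M M0 hv] := bv.
have [r [C [L [q fr]]]] := frames O0.
have C0 := frame_C fr.
have h0 : nm (l0 - l0) < r by rewrite subrr nm0 (frame_r fr).
have q0 := frame_coord_linear fr h0; have k0 := frame_ker fr h0.
rewrite (regular_det q0 k0 bv).
set A := coord_mx (q l0) v => dA.
have uA : A \in unitmx by rewrite unitmxE unitfE.
pose S := \sum_i \sum_j nm (invmx A i j).
have S0 : 0 <= S by apply: sumr_ge0 => i _; apply: sumr_ge0 => j _; exact: nm_ge0.
pose D := n%:R * (C * M * S) + 1.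
have D0 : 0 < D by rewrite ltr_wpDl// !mulr_ge0.
exists (Num.min r D^-1).
  by rewrite lt_min (frame_r fr) invr_gt0.
move=> l Ol; rewrite lt_min => /andP[lr lD].
have ql := frame_coord_linear fr lr; have kl := frame_ker fr lr.
rewrite (regular_det ql kl bv).
apply/negP => /det0P[c c0 hc].
set t := nm (l - l0) in lD.
have t0 : 0 <= t by exact: nm_ge0.
pose E := (A - coord_mx (q l) v) *m invmx A.
have cE : c = c *m E.
  by rewrite /E mulmxA mulmxBr hc subr0 mulmxK.
have nE i j : nm (E i j) <= C * M * t * S.
  rewrite mxE; apply: le_trans (nm_sum _) _.
  apply: (@le_trans _ _ (\sum_k (C * M * t) * nm (invmx A k j))).
    apply: ler_sum => k _; rewrite nmM ler_wpM2r ?nm_ge0//.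
    by rewrite !mxE nmBC; exact: (frame_cont fr).
  rewrite -mulr_sumr ler_wpM2l ?mulr_ge0//; apply: ler_sum => k _.
  by rewrite (bigD1 j)//= lerDl sumr_ge0// => ? _; exact: nm_ge0.
pose s := \sum_j nm (c 0 j).
have s0 : 0 <= s by apply: sumr_ge0 => ? _; exact: nm_ge0.
have : s <= n%:R * (C * M * t * S) * s.
  rewrite {1}/s -[n in leRHS]card_ord -sumr_const -mulrA mulr_suml.
  apply: ler_sum => j _; rewrite mul1r {1}cE mxE; apply: le_trans (nm_sum _) _.
  rewrite [leRHS]mulrC /s mulr_suml; apply: ler_sum => i _; rewrite nmM.
  by rewrite ler_wpM2l ?nm_ge0.
have tD : t * D < 1 by rewrite -ltr_pdivlMr// mul1r.
have h1 : n%:R * (C * M * t * S) < 1 by rewrite /D in tD; nra.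
move=> h2.
have s1 : s = 0 by apply/le_anti; rewrite s0 andbT; nra.
move/negP: c0; apply; apply/eqP/rowP => j; rewrite mxE; apply: nm_eq0.
have /eqP := s1; rewrite psumr_eq0; last by move=> ? _; exact: nm_ge0.
by move=> /allP/(_ j); rewrite mem_index_enum => /(_ isT)/eqP.
Qed.

Hypothesis Om_open : open Om.
Hypothesis Om_conn : connected Om.

(** Singularity in a whole neighbourhood is a locally constant property of the point by
    [zero_dichotomy], and it fails at [l1]. *)
Lemma remove_zeros_at v l1 l0 : bounded_tuple v -> Om l1 -> regular l1 v -> Om l0 ->
  exists v', [/\ bounded_tuple v', regular l0 v' &
     forall l, Om l -> l != l0 -> (regular l v' <-> regular l v)].
Proof.
move=> bv O1 reg1 O0.
pose sing l0 := exists2 rho : R, 0 < rho &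
  forall l, Om l -> nm (l - l0) < rho -> ~ regular l v.
suff : ~ sing l0 by case: (zero_dichotomy O0 bv).
apply: (@connected_locally_constant _ Om (fun l => ~ sing l) Om_conn _ _ _ O1 O0);
  last by move=> [rho rho0 /(_ l1 O1)]; rewrite subrr nm0 => /(_ rho0).
move=> l2 O2; case: (zero_dichotomy O2 bv) => [[rho rho0 hs]|[v' [bv' reg' eqv]]].
- exists rho => // l Ol hl.
  suff : sing l by have : sing l2 by [exists rho]; tauto.
  have d0 : 0 < rho - nm (l - l2) by rewrite subr_gt0.
  exists (rho - nm (l - l2)) => // l' Ol' hl'; apply: hs => //.
  by rewrite -(subrKA l); apply: le_lt_trans (nmD _ _) _; lra.
- have [rho rho0 hr] := regular_near O2 bv' reg'.
  have [s s0 hO] := openP_nm Om_open O2.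
  have nsing l : Om l -> nm (l - l2) < Num.min rho s -> ~ sing l.
    move=> Ol hl [e e0 he].
    suff [l' [Ol' ll2 le ll]] : exists l', [/\ Om l', l' != l2, nm (l' - l) < e &
        nm (l' - l2) < rho].
      by apply: (he l' Ol' le); apply/eqv => //; exact: hr.
    (* The factorisation says nothing at [l2] itself: there a nearby point is used. *)
    have [E|ll2] := eqVneq l l2; last first.
      exists l; split => //; first by rewrite subrr nm0.
      by move: hl; rewrite lt_min => /andP[].
    pose d := Num.min e (Num.min rho s) / 2.
    have d0 : 0 < Num.min e (Num.min rho s) by rewrite !lt_min e0 rho0.
    have [de dr ds] : [/\ d < e, d < rho & d < s].
      have h1 : Num.min e (Num.min rho s) <= e by rewrite ge_min lexx.
      have h2 : Num.min e (Num.min rho s) <= rho by rewrite !ge_min lexx orbT.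
      have h3 : Num.min e (Num.min rho s) <= s by rewrite !ge_min lexx !orbT.
      by rewrite /d; split; lra.
    have dg0 : 0 < d by rewrite divr_gt0.
    have nd : nm ((d%:C)%C : K) = d by rewrite nm_real gtr0_norm.
    exists (l2 + ((d%:C)%C : K)); rewrite E addrAC subrr add0r nd; split => //.
    + by apply: hO; rewrite addrAC subrr add0r nd.
    + rewrite -subr_eq0 addrAC subrr add0r; apply/eqP => h0.
      by move: nd; rewrite h0 nm0 => d00; rewrite -d00 ltxx in dg0.
  exists (Num.min rho s) => [|l Ol hl]; first by rewrite lt_min rho0.
  have := nsing l Ol hl; have := nsing l2 O2.
  by rewrite subrr nm0 lt_min rho0 s0 => /(_ isT); tauto.
Qed.

(** Singular points are isolated, hence a compact set has finitely many, and removing one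
    of them creates no other. *)
Lemma remove_all_zeros v l1 (Kc : set K) : bounded_tuple v -> Om l1 -> regular l1 v ->
  compact Kc -> Kc `<=` Om -> exists2 v', bounded_tuple v' & forall l, Kc l -> regular l v'.
Proof.
move=> bv O1 reg1 cK KO.
have isol l0 : exists rho : R, Kc l0 -> 0 < rho /\
    forall l, Om l -> nm (l - l0) < rho -> l != l0 -> regular l v.
  have [K0|] := pselect (Kc l0); last by exists 0.
  have [v' [bv' reg' eqv]] := remove_zeros_at bv O1 reg1 (KO _ K0).
  have [rho rho0 h] := regular_near (KO _ K0) bv' reg'.
  by exists rho => _; split => // l Ol hl ll0; apply/eqv => //; exact: h.
have [rho hrho] := choice isol.
have [s hs] : exists s : seq K, forall l, Kc l -> l \notin s -> regular l v.
  have := cK; rewrite compact_cover.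
  move=> /(_ _ Kc (fun l0 => [set l | nm (l - l0) < rho l0])) [].
  - move=> l0 K0; rewrite openE => l /= hl; apply/nbhs_nm.
    exists (rho l0 - nm (l - l0)); first by rewrite subr_gt0.
    move=> l' hl' /=; rewrite -(subrKA l); apply: le_lt_trans (nmD _ _) _.
    by rewrite (nmBC l' l); lra.
  - by move=> l Kl; exists l => //=; rewrite subrr nm0; have [] := hrho l Kl.
  - move=> D' sD cov; exists (finmap.enum_fset D') => l Kl nl.
    have [l0 /= l0D hl] := cov l Kl.
    have K0 : Kc l0 by apply/set_mem/sD.
    have [_ h] := hrho l0 K0; apply: h => //; first exact: KO.
    by apply: contraNneq nl => ->.
elim: s v l1 bv O1 reg1 hs {isol rho hrho} => [|l0 s ih] v l1 bv O1 reg1 hs.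
  by exists v => // l Kl; exact: hs.
have [K0|nK0] := pselect (Kc l0); last first.
  apply: ih bv O1 reg1 _ => l Kl ls; apply: hs => //.
  by rewrite inE negb_or ls andbT; apply: contra_not_neq nK0 => <-.
have [v' [bv' reg' eqv]] := remove_zeros_at bv O1 reg1 (KO _ K0).
apply: (ih v' l0 bv' (KO _ K0) reg') => l Kl ls.
have [->//|ll0] := eqVneq l l0.
apply/eqv => //; first exact: KO.
by apply: hs => //; rewrite inE negb_or ll0.
Qed.

End ZeroRemoval.

(** * Dual bases and bordered operators *)

Section Bordered.
Context {R : realType}.
Local Notation K := (Cplx R).

Section Functionals.
Variable X : normedModType K.

(** The bound is part of the data, and nonnegative, so that functionals fit the
    size relation used for removing zeros. *)
Definition bfun (f : X -> K) (C : R) :=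
  [/\ 0 <= C, forall a x y, f (a *: x + y) = a * f x + f y &
      forall x, nm (f x) <= C * nm x].

Lemma bfun_mono f C C' : bfun f C -> C <= C' -> bfun f C'.
Proof.
move=> [C0 fl fb] CC'; split => //; first exact: le_trans C0 CC'.
by move=> x; apply: le_trans (fb x) _; rewrite ler_wpM2r ?nm_ge0.
Qed.

Lemma add_funE (f g : X -> K) x : (f + g) x = f x + g x. Proof. by []. Qed.
Lemma opp_funE (f : X -> K) x : (- f) x = - f x. Proof. by []. Qed.
Lemma scale_funE a (f : X -> K) x : (a *: f) x = a * f x. Proof. by []. Qed.

Lemma bfun0 : bfun 0 0.
Proof. by split => // [a x y|x]; rewrite ?mulr0 ?addr0 // nm0 mul0r. Qed.

Lemma bfunD f g C D : bfun f C -> bfun g D -> bfun (f + g) (C + D).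
Proof.
move=> [C0 fl fb] [D0 gl gb]; split => [|a x y|x]; first exact: addr_ge0.
- by rewrite !add_funE fl gl mulrDr addrACA.
- by rewrite add_funE mulrDl; apply: le_trans (nmD _ _) (lerD (fb x) (gb x)).
Qed.

Lemma bfunZ a f C : bfun f C -> bfun (a *: f) (nm a * C).
Proof.
move=> [C0 fl fb]; split => [|b x y|x]; first by rewrite mulr_ge0 ?nm_ge0.
- by rewrite !scale_funE fl mulrDr mulrCA.
- by rewrite scale_funE nmM -mulrA ler_wpM2l ?nm_ge0.
Qed.

Lemma bfunN f C : bfun f C -> bfun (- f) C.
Proof. by move/(bfunZ (-1)); rewrite nmN nm1 mul1r scaleN1r. Qed.

Section lin.
Variables (f : X -> K) (C : R) (hf : bfun f C).
Lemma bfun_0 : f 0 = 0.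
Proof.
have [_ fl _] := hf; have := fl (-1) 0 0.
by rewrite scaler0 addr0 mulN1r addNr.
Qed.
Lemma bfun_D x y : f (x + y) = f x + f y.
Proof. by have [_ fl _] := hf; rewrite -{1}(scale1r x) fl mul1r. Qed.
Lemma bfun_Z a x : f (a *: x) = a * f x.
Proof. by have [_ fl _] := hf; rewrite -{1}(addr0 (a *: x)) fl bfun_0 addr0. Qed.
Lemma bfun_B x y : f (x - y) = f x - f y.
Proof. by rewrite bfun_D -scaleN1r bfun_Z mulN1r. Qed.
Lemma bfun_sum (I : finType) (F : I -> X) : f (\sum_i F i) = \sum_i f (F i).
Proof.
elim/big_ind2 : _ => //; first exact: bfun_0.
by move=> a b c d <- <-; exact: bfun_D.
Qed.
End lin.

Lemma bfun_sumf (I : finType) (F : I -> X -> K) (C : I -> R) :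
  (forall i, bfun (F i) (C i)) -> bfun (\sum_i F i) (\sum_i C i).
Proof. by move=> h; elim/big_ind2 : _ => // *; [exact: bfun0 | exact: bfunD]. Qed.

Definition independent n (e : 'I_n -> X) :=
  forall c : 'I_n -> K, \sum_i c i *: e i = 0 -> forall i, c i = 0.

(** By induction: [e0] is the component of the first vector that the functionals dual
    to the others do not see, Hahn-Banach separates it from 0, and both sides are then
    corrected to be dual to each other. *)
Lemma dual_basis n (e : 'I_n -> X) : independent e ->
  exists f : 'I_n -> X -> K, (forall i, exists C, bfun (f i) C) /\
    forall i j, f i (e j) = (i == j)%:R.
Proof.
elim: n e => [|n ih] e ind; first by exists (fun _ => 0); split => -[].
pose e1 j := e (lift ord0 j).
have [|f [bf hf]] := ih e1.
  move=> c hc j.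
  pose c' i := if unlift ord0 i is Some k then c k else 0.
  have := ind c' _ (lift ord0 j); rewrite /c' liftK; apply.
  rewrite big_ord_recl unlift_none scale0r add0r -[RHS]hc.
  by apply: eq_bigr => i _; rewrite liftK.
have [C hC] := choice bf.
pose e0 := e ord0 - \sum_j f j (e ord0) *: e1 j.
have e00 : e0 != 0.
  apply/eqP => h.
  pose c' i := if unlift ord0 i is Some k then - f k (e ord0) else 1.
  have hc' : \sum_i c' i *: e i = 0.
    rewrite big_ord_recl /c' unlift_none scale1r -[RHS]h; congr (_ + _).
    by rewrite -sumrN; apply: eq_bigr => i _; rewrite liftK scaleNr.
  by have := ind c' hc' ord0; rewrite /c' unlift_none => /eqP; rewrite oner_eq0.
have [g [gl [D D0 gb] ge]] := hahn_banach e00.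
have bg : bfun g D by [].
have fe0 j : f j e0 = 0.
  rewrite /e0 (bfun_B (hC j)) (bfun_sum (hC j)) (bigD1 j)//= big1 ?addr0.
    by rewrite (bfun_Z (hC j)) hf eqxx mulr1 subrr.
  by move=> i ij; rewrite (bfun_Z (hC j)) hf eq_sym (negPf ij) mulr0.
pose g1 : X -> K := g - \sum_j g (e1 j) *: f j.
have bg1 : exists C1, bfun g1 C1.
  exists (D + \sum_j nm (g (e1 j)) * C j); apply: bfunD => //; apply: bfunN.
  by apply: bfun_sumf => j; exact: bfunZ.
have g1E x : g1 x = g x - \sum_j g (e1 j) * f j x.
  by rewrite /g1 add_funE opp_funE fct_sumE.
have [C1 hg1] := bg1.
have g1e1 j : g1 (e1 j) = 0.
  rewrite g1E (bigD1 j)//= hf eqxx mulr1 big1 ?addr0 ?subrr// => i ij.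
  by rewrite hf (negPf ij) mulr0.
have g1e : g1 (e ord0) = 1.
  have -> : e ord0 = e0 + \sum_j f j (e ord0) *: e1 j by rewrite subrK.
  rewrite (bfun_D hg1) (bfun_sum hg1) [X in _ + X]big1 ?addr0.
    rewrite g1E ge big1 ?subr0// => j _.
    by rewrite fe0 mulr0.
  by move=> j _; rewrite (bfun_Z hg1) g1e1 mulr0.
exists (fun i => if unlift ord0 i is Some k then f k - f k (e ord0) *: g1 else g1).
split => [i|i j].
  case: unliftP => [k _|_]; last by exists C1.
  by exists (C k + nm (f k (e ord0)) * C1); apply: bfunD => //; apply/bfunN/bfunZ.
have fE k x : (f k - f k (e ord0) *: g1) x = f k x - f k (e ord0) * g1 x by [].
case: (unliftP ord0 i) => [k|] ->; case: (unliftP ord0 j) => [k'|] ->.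
- by rewrite fE -/(e1 k') g1e1 mulr0 subr0 hf (inj_eq (@lift_inj _ ord0)).
- by rewrite fE g1e mulr1 subrr eq_sym (negPf (neq_lift _ _)).
- by rewrite -/(e1 k') g1e1 (negPf (neq_lift _ _)).
- by rewrite g1e eqxx.
Qed.

End Functionals.

Section LinearAlgebra.
Variables (X Y : lmodType K) (A : {linear X -> Y}).

Lemma form_comb (V : lmodType K) n (g : V -> K) (c : 'I_n -> K) (e : 'I_n -> V) :
  (forall a x y, g (a *: x + y) = a * g x + g y) ->
  g (\sum_i c i *: e i) = \sum_i c i * g (e i).
Proof.
move=> gl; have g0 : g 0 = 0.
  by have := gl (-1) 0 0; rewrite scaler0 addr0 mulN1r addNr.
have : forall s : seq 'I_n, g (\sum_(i <- s) c i *: e i) = \sum_(i <- s) c i * g (e i).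
  by elim=> [|i s ih]; rewrite ?big_nil ?g0// !big_cons gl ih.
exact.
Qed.

Lemma dual_coords n (f : 'I_n -> X -> K) (u : 'I_n -> X) (c : 'I_n -> K) :
  (forall i a x y, f i (a *: x + y) = a * f i x + f i y) ->
  (forall i j, f i (u j) = (i == j)%:R) ->
  forall i, f i (\sum_j c j *: u j) = c i.
Proof.
move=> fl fu i; rewrite (form_comb _ _ (fl i)) (bigD1 i)//= fu eqxx mulr1 big1 ?addr0//.
by move=> j ji; rewrite fu eq_sym (negPf ji) mulr0.
Qed.

Lemma null_basis n (b : 'I_n -> X) :
  nullspace A = range (fun a : 'I_n -> K => \sum_i a i *: b i) -> forall j, A (b j) = 0.
Proof.
move=> bE j; have : nullspace A (b j); last by [].
rewrite bE; exists (fun i => (i == j)%:R) => //.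
rewrite (bigD1 j)//= eqxx scale1r big1 ?addr0// => i /negPf ->.
by rewrite scale0r.
Qed.

Lemma sum_mxE (V : lmodType K) m n (D : 'M[K]_(m, n)) (c : 'I_m -> K) (e : 'I_n -> V) :
  \sum_i c i *: (\sum_j D i j *: e j) = \sum_j ((\row_i c i) *m D) 0 j *: e j.
Proof.
under eq_bigr => i _ do rewrite scaler_sumr.
rewrite exchange_big /=; apply: eq_bigr => j _.
rewrite mxE scaler_suml; apply: eq_bigr => i _.
by rewrite scalerA mxE.
Qed.

Lemma linear_comb n (c : 'I_n -> K) (e : 'I_n -> X) :
  A (\sum_i c i *: e i) = \sum_i c i *: A (e i).
Proof. by rewrite linear_sum; apply: eq_bigr => i _; rewrite linearZ. Qed.

Lemma bordered_lin m (w : 'I_m -> Y) a x x' (c c' : 'I_m -> K) :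
  A (a *: x + x') + \sum_j (a * c j + c' j) *: w j =
  a *: (A x + \sum_j c j *: w j) + (A x' + \sum_j c' j *: w j).
Proof.
under eq_bigr => j _ do rewrite scalerDl -scalerA.
by rewrite big_split -scaler_sumr linearP addrACA -scalerDr.
Qed.

Definition free_mod m (w : 'I_m -> Y) :=
  forall c : 'I_m -> K, range A (\sum_i c i *: w i) -> forall i, c i = 0.

Lemma rangeB y z : range A y -> range A z -> range A (y - z).
Proof. by move=> [x _ <-] [x' _ <-]; exists (x - x') => //; rewrite linearB. Qed.
Lemma rangeZ a y : range A y -> range A (a *: y).
Proof. by move=> [x _ <-]; exists (a *: x) => //; rewrite linearZ. Qed.
Lemma range_comb n (c : 'I_n -> K) y : (forall i, range A (y i)) -> range A (\sum_i c i *: y i).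
Proof.
move=> h; elim/big_ind : _ => [|u v hu hv|i _]; first by exists 0 => //; rewrite linear0.
  by rewrite -[v]opprK; apply: rangeB => //; rewrite -scaleN1r; exact: rangeZ.
exact: rangeZ.
Qed.

Lemma codim_coords m k (w : 'I_m -> Y) (e : 'I_k -> Y) :
  (forall v, exists a : 'I_k -> K, range A (v - \sum_i a i *: e i)) ->
  exists D : 'M[K]_(m, k), forall c : 'I_m -> K,
    range A (\sum_i c i *: w i - \sum_j ((\row_i c i) *m D) 0 j *: e j).
Proof.
move=> sp; have [D hD] := choice (fun i => sp (w i)).
exists (\matrix_(i, j) D i j) => c; rewrite -sum_mxE -sumrB.
under eq_bigr => i _ do rewrite -scalerBr.
apply: range_comb => i.
by under eq_bigr => j _ do rewrite mxE.
Qed.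

Lemma free_mod_row_free m k (w : 'I_m -> Y) (e : 'I_k -> Y) (D : 'M[K]_(m, k)) :
  (forall c : 'I_m -> K,
    range A (\sum_i c i *: w i - \sum_j ((\row_i c i) *m D) 0 j *: e j)) ->
  free_mod w -> row_free D.
Proof.
move=> hD fr; rewrite -kermx_eq0; apply/eqP/row_matrixP => i; rewrite row0.
set c := row i _.
have cD : c *m D = 0 by rewrite /c -row_mul mulmx_ker row0.
have cE : \row_j c 0 j = c by apply/rowP => j; rewrite mxE.
have := hD (fun j => c 0 j); rewrite cE cD.
under [X in _ - X]eq_bigr => j _ do rewrite mxE scale0r.
rewrite [X in _ - X]big1// subr0 => /fr h; apply/rowP => j; rewrite h mxE//.
Qed.

Lemma free_mod_le m k (w : 'I_m -> Y) : free_mod w -> has_codim (range A) k -> (m <= k)%N.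
Proof.
move=> fr [e [_ sp]]; have [D hD] := codim_coords w sp.
have := free_mod_row_free hD fr; rewrite /row_free => /eqP <-.
exact: rank_leq_col.
Qed.

Lemma has_codim_uniq m k : has_codim (range A) m -> has_codim (range A) k -> m = k.
Proof.
move=> hm hk; apply/eqP; rewrite eqn_leq.
by case: (hm) => w [fw _]; case: (hk) => e [fe _]; rewrite (free_mod_le fw hk) (free_mod_le fe hm).
Qed.

Lemma free_mod_spanning m (w : 'I_m -> Y) : free_mod w -> has_codim (range A) m ->
  forall y, exists c : 'I_m -> K, range A (y - \sum_i c i *: w i).
Proof.
move=> fr [e [_ sp]] y; have [D hD] := codim_coords w sp.
have uD : D \in unitmx by rewrite -row_free_unit; exact: free_mod_row_free hD fr.
have [a ha] := sp y.
pose c := (\row_i a i) *m invmx D.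
exists (fun i => c 0 i).
have := hD (fun i => c 0 i).
have -> : \row_i c 0 i = c by apply/rowP => j; rewrite mxE.
rewrite mulmxKV// => /(rangeB ha).
under [X in _ - (_ - X)]eq_bigr => j _ do rewrite mxE.
by rewrite opprB addrA subrK.
Qed.

(** The matrix of the values of the [f i] on a basis of the null space is square, so
    independence on either side makes it invertible. *)
Lemma null_dual n (f : 'I_n -> X -> K) :
  has_dim (nullspace A) n ->
  (forall i a x y, f i (a *: x + y) = a * f i x + f i y) ->
  (forall c : 'I_n -> K, (forall x, A x = 0 -> \sum_i c i * f i x = 0) -> forall i, c i = 0) \/
  (forall x, A x = 0 -> (forall i, f i x = 0) -> x = 0) ->
  (forall x, A x = 0 -> (forall i, f i x = 0) -> x = 0) /\
  exists u : 'I_n -> X, (forall j, A (u j) = 0) /\ forall i j, f i (u j) = (i == j)%:R.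
Proof.
move=> [b [bi bE]] fl hyp.
have Ab := null_basis bE.
have fsum i (c : 'I_n -> K) : f i (\sum_j c j *: b j) = \sum_j c j * f i (b j).
  exact: form_comb.
pose F : 'M[K]_n := \matrix_(j, i) f i (b j).
have fF i (c : 'I_n -> K) : f i (\sum_j c j *: b j) = ((\row_j c j) *m F) 0 i.
  by rewrite fsum mxE; apply: eq_bigr => j _; rewrite !mxE.
have Asum (c : 'I_n -> K) : A (\sum_j c j *: b j) = 0.
  by rewrite linear_comb big1// => j _; rewrite Ab scaler0.
have uF : F \in unitmx.
  case: hyp => h.
    rewrite -unitmx_tr -row_free_unit -kermx_eq0; apply/eqP/row_matrixP => i; rewrite row0.
    set c := row i _.
    have cF : c *m F^T = 0 by rewrite /c -row_mul mulmx_ker row0.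
    apply/rowP => j; rewrite [RHS]mxE; apply: (h (fun j => c 0 j)) => x Ax.
    have : nullspace A x by [].
    rewrite bE => -[a _ <-].
    under eq_bigr => k _ do rewrite fsum mulr_sumr.
    rewrite exchange_big /= big1// => k _.
    under eq_bigr => l _ do rewrite mulrCA.
    rewrite -mulr_sumr.
    have -> : \sum_l c 0 l * f l (b k) = (c *m F^T) 0 k.
      by rewrite [RHS]mxE; apply: eq_bigr => l _; congr (_ * _); rewrite !mxE.
    by rewrite cF mxE mulr0.
  rewrite -row_free_unit -kermx_eq0; apply/eqP/row_matrixP => i; rewrite row0.
  set c := row i _.
  have cF : c *m F = 0 by rewrite /c -row_mul mulmx_ker row0.
  have cE : \row_j c 0 j = c by apply/rowP => j; rewrite mxE.
  apply/rowP => j; rewrite [RHS]mxE; apply: (bi (fun j => c 0 j)); apply: h => // k.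
  by rewrite fF cE cF mxE.
split.
  move=> x Ax hx; have : nullspace A x by [].
  rewrite bE => -[a _ aE].
  have aF : (\row_j a j) *m F = 0 by apply/rowP => i; rewrite -fF aE hx mxE.
  have a0 : \row_j a j = 0 by rewrite -[LHS](mulmxK uF) aF mul0mx.
  rewrite -aE big1// => j _.
  by have /rowP/(_ j) := a0; rewrite !mxE => ->; rewrite scale0r.
exists (fun k => \sum_j invmx F k j *: b j); split => [k|i k]; first exact: Asum.
rewrite fF.
have -> : \row_j invmx F k j = row k (invmx F) by apply/rowP => j; rewrite !mxE.
by rewrite -row_mul mulVmx// !mxE eq_sym.
Qed.

(** The map [(x, c) |-> A x + sum c_j w_j] from (common kernel of the [f i]) x [K^m] to [Y] is
    bijective. For a Fredholm operator this says that this kernel is a complement of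
    the null space and that the [w j] span a complement of the range. *)
Definition bordered n m (f : 'I_n -> X -> K) (w : 'I_m -> Y) :=
  (forall x (c : 'I_m -> K), A x + \sum_j c j *: w j = 0 -> (forall i, f i x = 0) ->
     x = 0 /\ forall j, c j = 0) /\
  (forall y, exists x, exists2 c : 'I_m -> K, y = A x + \sum_j c j *: w j &
     forall i, f i x = 0).

(** A preimage under [A] is moved into the common kernel of the [f i] by subtracting a
    combination of the dual vectors [u i], which [A] does not see. *)
Lemma bordered_intro n m (f : 'I_n -> X -> K) (w : 'I_m -> Y) (u : 'I_n -> X) :
  (forall i a x y, f i (a *: x + y) = a * f i x + f i y) ->
  (forall x, A x = 0 -> (forall i, f i x = 0) -> x = 0) ->
  (forall j, A (u j) = 0) -> (forall i j, f i (u j) = (i == j)%:R) ->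
  free_mod w -> (forall y, exists c : 'I_m -> K, range A (y - \sum_i c i *: w i)) ->
  bordered f w.
Proof.
move=> fl finj Au fu fr sp; split.
  move=> x c /eqP; rewrite addr_eq0 => /eqP hx fx.
  have c0 : forall j, c j = 0.
    by apply: fr; exists (- x) => //; rewrite linearN hx opprK.
  split => //; apply: finj => //; rewrite hx big1 ?oppr0// => j _.
  by rewrite c0 scale0r.
move=> y; have [c [x0 _ hx0]] := sp y.
exists (- (\sum_i f i x0 *: u i) + x0), c => [|i].
  rewrite linearD linearN linear_comb big1; last by move=> i _; rewrite Au scaler0.
  by rewrite oppr0 add0r hx0 subrK.
by rewrite -scaleN1r fl (dual_coords _ fl fu) mulN1r addNr.
Qed.

Lemma bordered_free n m (f : 'I_n -> X -> K) (w : 'I_m -> Y) (u : 'I_n -> X) :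
  (forall i a x y, f i (a *: x + y) = a * f i x + f i y) ->
  (forall j, A (u j) = 0) -> (forall i j, f i (u j) = (i == j)%:R) ->
  bordered f w -> free_mod w.
Proof.
move=> fl Au fu [inj _] c [x _ hx].
have [] // := inj ((-1) *: x + \sum_i f i x *: u i) c.
  rewrite linearD linearZ /= linear_comb [X in _ + X + _]big1 ?addr0 ?scaleN1r ?hx ?addNr//.
  by move=> i _; rewrite Au scaler0.
by move=> i; rewrite fl (dual_coords _ fl fu) mulN1r addNr.
Qed.

End LinearAlgebra.
End Bordered.

(** * Inverting bordered operators *)

Section BorderedInverse.
Context {R : realType}.
Local Notation K := (Cplx R).
Variables (X Y : completeNormedModType K) (n m : nat).
Variables (f : 'I_n -> X -> K) (Cf : R) (w : 'I_m -> Y).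
Hypothesis bf : forall i, bfun (f i) Cf.
Let Wn := \sum_j nm (w j).

Let Wn_ge0 : 0 <= Wn.
Proof. by apply: sumr_ge0 => j _; exact: nm_ge0. Qed.

Let nm_comb (c : 'I_m -> K) (b : R) : (forall j, nm (c j) <= b) ->
  nm (\sum_j c j *: w j) <= b * Wn.
Proof.
move=> h; apply: le_trans (nm_sum _) _; rewrite mulr_sumr; apply: ler_sum => j _.
by rewrite nmZ ler_wpM2r ?nm_ge0.
Qed.

Definition inverse_of (A : {linear X -> Y}) (G : Y -> X) (E : Y -> 'I_m -> K) :=
  forall y, y = A (G y) + \sum_j E y j *: w j /\ forall i, f i (G y) = 0.

Lemma bordered_uniq (A : {linear X -> Y}) G E x c y : bordered A f w -> inverse_of A G E ->
  y = A x + \sum_j c j *: w j -> (forall i, f i x = 0) -> x = G y /\ forall j, c j = E y j.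
Proof.
move=> [inj _] inv yE fx; have [yE' fG] := inv y.
have [||h1 h2] := inj (x - G y) (fun j => c j - E y j).
- under eq_bigr => j _ do rewrite scalerBl.
  by rewrite sumrB linearB addrACA -opprD -yE -yE' subrr.
- by move=> i; rewrite (bfun_B (bf i)) fx fG subrr.
split; first by apply/eqP; rewrite -subr_eq0 h1.
by move=> j; apply/eqP; rewrite -subr_eq0 h2.
Qed.

Lemma inverse_lin (A : {linear X -> Y}) G E : bordered A f w -> inverse_of A G E ->
  forall a y y', G (a *: y + y') = a *: G y + G y' /\
    forall j, E (a *: y + y') j = a * E y j + E y' j.
Proof.
move=> brd inv a y y'; have [e1 f1] := inv y; have [e2 f2] := inv y'.
have [||h1 h2] := @bordered_uniq A G E (a *: G y + G y')
    (fun j => a * E y j + E y' j) (a *: y + y') brd inv.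
- by rewrite bordered_lin -e1 -e2.
- by move=> i; have [_ fl _] := bf i; rewrite fl f1 f2 mulr0 addr0.
by split => // j; rewrite h2.
Qed.

Lemma inverse_B (A : {linear X -> Y}) G E : bordered A f w -> inverse_of A G E ->
  forall y y', G (y - y') = G y - G y' /\ forall j, E (y - y') j = E y j - E y' j.
Proof.
move=> brd inv y y'; have [h1 h2] := inverse_lin brd inv (-1) y' y.
have -> : y - y' = (-1) *: y' + y by rewrite scaleN1r addrC.
by rewrite h1 scaleN1r; split => [|j]; [rewrite addrC | rewrite h2 mulN1r addrC].
Qed.

Lemma inverse_Z (A : {linear X -> Y}) G E : bordered A f w -> inverse_of A G E ->
  forall a y, G (a *: y) = a *: G y /\ forall j, E (a *: y) j = a * E y j.
Proof.
move=> brd inv a y; have [h1 h2] := inverse_lin brd inv a y 0.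
have [h3 h4] := inverse_B brd inv 0 0; rewrite !subrr in h3 h4.
rewrite addr0 in h1 h2; split => [|j]; first by rewrite h1 h3 addr0.
by rewrite h2 h4 subrr addr0.
Qed.

(** The cost of [y] is the size of its solution.  Countable additivity of this cost is the
    closed graph property: as [r k] tends to 0, the solutions for [r k] converge to a
    solution for 0, which is 0. *)
Lemma bordered_inverse (A : {linear X -> Y}) (a : R) :
  0 <= a -> (forall x, nm (A x) <= a * nm x) -> bordered A f w ->
  exists G, exists2 E, inverse_of A G E & exists2 C : R, 0 <= C &
    forall y, nm (G y) <= C * nm y /\ forall j, nm (E y j) <= C * nm y.
Proof.
move=> a0 bA brd; have [inj surj] := brd.
have /choice[GE inv] : forall y, exists p : X * ('I_m -> K),
    y = A p.1 + \sum_j p.2 j *: w j /\ forall i, f i p.1 = 0.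
  by move=> y; have [x [c yE fx]] := surj y; exists (x, c).
pose G y := (GE y).1; pose E y := (GE y).2.
have {}inv : inverse_of A G E by [].
pose P y (M : R) := nm (G y) <= M /\ forall j, nm (E y j) <= M.
have GEB := inverse_B brd inv; have GEZ := inverse_Z brd inv.
have [C C0 hC] : exists2 C : R, 0 <= C & forall y, P y (C * nm y).
  apply: (@gauge_bounded _ Y P).
  - move=> y M M' [h1 h2] MM'; split; first exact: le_trans MM'.
    by move=> j; exact: le_trans MM'.
  - move=> y y' M M' [h1 h2] [h1' h2']; have [gE eE] := GEB y y'.
    split; first by rewrite gE; apply: le_trans (nmD _ _) _; rewrite nmN lerD.
    by move=> j; rewrite eE; apply: le_trans (nmD _ _) _; rewrite nmN lerD.
  - move=> t y M [h1 h2]; have [gE eE] := GEZ t y.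
    split; first by rewrite gE nmZ ler_wpM2l ?nm_ge0.
    by move=> j; rewrite eE nmM ler_wpM2l ?nm_ge0.
  - move=> y; exists (nm (G y) + \sum_j nm (E y j)).
    have s0 : 0 <= \sum_j nm (E y j) by apply: sumr_ge0 => j _; exact: nm_ge0.
    split; first by rewrite lerDl.
    move=> j; rewrite (bigD1 j)//= addrCA lerDl addr_ge0 ?nm_ge0//.
    by apply: sumr_ge0 => i _; exact: nm_ge0.
  - move=> r M N hP hr.
    have dE k : G (r k.+1) - G (r k) = - G (r k - r k.+1).
      by have [-> _] := GEB (r k) (r k.+1); rewrite opprB.
    have dE' k j : E (r k.+1) j - E (r k) j = - E (r k - r k.+1) j.
      by have [_ ->] := GEB (r k) (r k.+1); rewrite opprB.
    have [|l hl] := @banach_geo_complete _ X (fun k => G (r k)) M.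
      by move=> k; rewrite dE nmN; have [] := hP k.
    have /choice[d hd] : forall j, exists d, forall k, nm (d - E (r k) j) <= 4 * M * 2^-1 ^+ k.
      move=> j; apply: (@cplx_geo_complete _ (fun k => E (r k) j) M) => k.
      by rewrite dE' nmN; have [_ ->] := hP k.
    have h0 : A l + \sum_j d j *: w j = 0.
      apply: (@nm_halfX_eq0 _ _ _ (N + a * (4 * M) + 4 * M * Wn)) => k.
      have [e1 _] := inv (r k).
      have -> : A l + \sum_j d j *: w j = r k + A (l - G (r k)) +
          \sum_j (d j - E (r k) j) *: w j.
        under [in RHS]eq_bigr => j _ do rewrite scalerBl.
        rewrite sumrB linearB [X in X + _ + _]e1; set u := A (G _); set v := \sum_j E _ _ *: _.
        by rewrite -addrA addrACA !subrKC.
      rewrite 2!mulrDl; apply: le_trans (nmD _ _) _; apply: lerD.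
        apply: le_trans (nmD _ _) _; apply: lerD; first exact: hr.
        by apply: le_trans (bA _) _; rewrite -mulrA; apply: ler_wpM2l => //; apply: hl.
      by rewrite mulrAC; apply: nm_comb => j; exact: hd.
    have fl i : f i l = 0.
      apply: (@nm_halfX_eq0 _ _ _ (Cf * (4 * M))) => k.
      have [_ fG] := inv (r k); have [Cf0 _ fb] := bf i.
      rewrite -[f i l]subr0 -(fG i) -(bfun_B (bf i)).
      by apply: le_trans (fb _) _; rewrite -mulrA; apply: ler_wpM2l => //; apply: hl.
    have [l0 d0] := inj l d h0 fl.
    split; first by have := hl 0%N; rewrite l0 sub0r nmN expr0 mulr1.
    by move=> j; have := hd j 0%N; rewrite d0 sub0r nmN expr0 mulr1.
exists G, E => //; exists C => // y; exact: hC.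
Qed.

Section Perturbation.
Variables (A0 S A : {linear X -> Y}) (t : K) (G0 : Y -> X) (E0 : Y -> 'I_m -> K) (C s : R).
Hypothesis AE : forall x, A x = A0 x - t *: S x.
Hypothesis brd0 : bordered A0 f w.
Hypothesis inv0 : inverse_of A0 G0 E0.
Hypothesis C0 : 0 <= C.
Hypothesis bGE : forall y, nm (G0 y) <= C * nm y /\ forall j, nm (E0 y j) <= C * nm y.
Hypothesis s0 : 0 <= s.
Hypothesis bS : forall x, nm (S x) <= s * nm x.
Hypothesis small : nm t * s * C <= 2^-1.

(** A solution of the perturbed system solves the original one for a corrected right side. *)
Lemma perturb_solution y x c : y = A x + \sum_j c j *: w j -> (forall i, f i x = 0) ->
  x = G0 (y + t *: S x) /\ forall j, c j = E0 (y + t *: S x) j.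
Proof.
move=> yE fx; apply: (@bordered_uniq A0) => //.
by rewrite yE AE addrAC subrK.
Qed.

Lemma perturb_bound y x c : y = A x + \sum_j c j *: w j -> (forall i, f i x = 0) ->
  [/\ nm x <= 2 * C * nm y, forall j, nm (c j) <= 2 * C * nm y &
      forall j, nm (c j - E0 y j) <= 2 * C * C * s * nm t * nm y].
Proof.
move=> yE fx; have [xE cE] := perturb_solution yE fx.
have hts : nm (t *: S x) <= nm t * s * nm x.
  by rewrite nmZ -mulrA ler_wpM2l ?nm_ge0.
have hy := nmD y (t *: S x).
have nx := nm_ge0 x; have ny := nm_ge0 y; have nt := nm_ge0 t.
have ts0 : 0 <= nm t * s by rewrite mulr_ge0.
have h1 : nm x <= 2 * C * nm y.
  have [h _] := bGE (y + t *: S x); rewrite -xE in h.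
  have := ler_wpM2l C0 (le_trans hy (lerD (lexx _) hts)).
  have := ler_wpM2r nx small; rewrite mulrDr => *; nra.
have ys : nm (y + t *: S x) <= 2 * nm y.
  apply: le_trans hy _; have := ler_wpM2l ts0 h1; have := ler_wpM2r ny small.
  by move: hts => *; nra.
split => // j.
  rewrite cE; have [_ /(_ j) h] := bGE (y + t *: S x); apply: le_trans h _.
  by rewrite (mulrC 2) -mulrA ler_wpM2l.
have [_ E0B] := inverse_B brd0 inv0 (y + t *: S x) y.
rewrite cE -E0B addrAC subrr add0r; have [_ /(_ j) h] := bGE (t *: S x).
apply: le_trans h _.
have -> : 2 * C * C * s * nm t * nm y = C * (nm t * s * (2 * C * nm y)) by ring.
by rewrite ler_wpM2l//; apply: le_trans hts _; rewrite ler_wpM2l.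
Qed.

(** A right side [z] of the original system gives a solution for [y] if [z = y + t S (G0 z)]. *)
Lemma perturb_bordered : bordered A f w.
Proof.
split.
  move=> x c h fx; have [h1 h2 _] := perturb_bound (esym h) fx.
  rewrite nm0 !mulr0 in h1 h2; split => [|j]; apply: nm_eq0; apply/le_anti.
    by rewrite h1 nm_ge0.
  by rewrite h2 nm_ge0.
move=> y.
have [||z zE] := @neumann _ Y (fun y => t *: S (G0 y)) _ _ y.
- by move=> u v; have [-> _] := inverse_B brd0 inv0 u v; rewrite linearB scalerBr.
- move=> u; have [h _] := bGE u; rewrite nmZ.
  apply: le_trans (_ : nm t * s * C * nm u <= _); last by rewrite ler_wpM2r ?nm_ge0.
  rewrite -!mulrA ler_wpM2l ?nm_ge0//; apply: le_trans (bS _) _.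
  by rewrite ler_wpM2l.
have [e1 f1] := inv0 z.
exists (G0 z), (E0 z) => //.
by rewrite AE addrAC -e1 {1}zE addrK.
Qed.

(** The difference [u - u0] solves the original system for the right side [t S u]. *)
Lemma perturb_null u u0 : A u = 0 -> A0 u0 = 0 -> (forall i, f i u = f i u0) ->
  nm u <= 2 * nm u0 /\ nm (u - u0) <= 2 * C * s * nm t * nm u0.
Proof.
move=> Au Au0 fu.
have [||vE _] := @bordered_uniq A0 G0 E0 (u - u0) (fun _ => 0) (t *: S u) brd0 inv0.
- rewrite big1 ?addr0; last by move=> j _; rewrite scale0r.
  by rewrite linearB Au0 subr0; have := AE u; rewrite Au => /esym/eqP; rewrite subr_eq0 => /eqP->.
- by move=> i; rewrite (bfun_B (bf i)) fu subrr.
have [h _] := bGE (t *: S u); rewrite -vE in h.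
have hts : nm (t *: S u) <= nm t * s * nm u.
  by rewrite nmZ -mulrA ler_wpM2l ?nm_ge0.
have nu := nm_ge0 u; have nt := nm_ge0 t.
have h2 := le_trans h (ler_wpM2l C0 hts).
have h1 : nm u <= 2 * nm u0.
  have := nmD (u - u0) u0; rewrite subrK => h3.
  have := ler_wpM2r nu small => *; nra.
split => //; apply: le_trans h2 _.
have -> : 2 * C * s * nm t * nm u0 = C * (nm t * s * (2 * nm u0)) by ring.
by rewrite ler_wpM2l// ler_wpM2l// mulr_ge0.
Qed.

End Perturbation.
End BorderedInverse.

(** * Linear pencils *)

Section Pencil.
Context {R : realType}.
Local Notation K := (Cplx R).
Variables (X Y : completeNormedModType K) (T S : {linear X -> Y}) (Om : set K).
Variables (aT aS : R) (n : nat).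
Hypothesis aT0 : 0 <= aT.
Hypothesis bT : forall x, nm (T x) <= aT * nm x.
Hypothesis aS0 : 0 <= aS.
Hypothesis bS : forall x, nm (S x) <= aS * nm x.
Hypothesis Om_open : open Om.
Hypothesis Om_conn : connected Om.
Hypothesis null_dim : forall l, Om l -> has_dim (nullspace (pencil T S l)) n.

Local Notation A := (pencil T S).

Lemma pencilE l x : A l x = T x - l *: S x. Proof. by []. Qed.

Lemma pencil_shift l l0 x : A l x = A l0 x - (l - l0) *: S x.
Proof. by rewrite !pencilE scalerBl opprB addrA subrK. Qed.

Lemma pencil_bound l : exists2 a : R, 0 <= a & forall x, nm (A l x) <= a * nm x.
Proof.
exists (aT + nm l * aS) => [|x]; first by rewrite addr_ge0// mulr_ge0 ?nm_ge0.
rewrite pencilE mulrDl; apply: le_trans (nmD _ _) _; rewrite nmN nmZ lerD// -mulrA.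
by rewrite ler_wpM2l ?nm_ge0.
Qed.

(** A bordered system that works near [l0], its inverse [(G l, E l)], and a basis [u l] of
    the null space dual to [f].  As [f] and [w] do not move with [l], all dependence on [l] is
    in [G], [E] and [u]. *)
Record local_system m (l0 : K) (f : 'I_n -> X -> K) (w : 'I_m -> Y) (r C : R)
    (G : K -> Y -> X) (E : K -> Y -> 'I_m -> K) (u : K -> 'I_n -> X) : Prop := LocalSystem {
  ls_r : 0 < r;
  ls_C : 0 <= C;
  ls_Om : forall l, nm (l - l0) < r -> Om l;
  ls_f : forall i, bfun (f i) C;
  ls_brd : forall l, nm (l - l0) < r -> bordered (A l) f w;
  ls_inv : forall l, nm (l - l0) < r -> inverse_of f w (A l) (G l) (E l);
  ls_G : forall l y, nm (l - l0) < r -> nm (G l y) <= C * nm y;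
  ls_E : forall l y j, nm (l - l0) < r -> nm (E l y j) <= C * nm y;
  ls_Ec : forall l y j, nm (l - l0) < r ->
    nm (E l y j - E l0 y j) <= C * nm (l - l0) * nm y;
  ls_null : forall l j, nm (l - l0) < r -> A l (u l j) = 0;
  ls_dual : forall l i j, nm (l - l0) < r -> f i (u l j) = (i == j)%:R;
  ls_u : forall l j, nm (l - l0) < r -> nm (u l j) <= C;
  ls_uc : forall l j, nm (l - l0) < r -> nm (u l j - u l0 j) <= C * nm (l - l0) }.

Lemma bfun_uniform (f : 'I_n -> X -> K) : (forall i, exists C, bfun (f i) C) ->
  exists2 C : R, 0 <= C & forall i, bfun (f i) C.
Proof.
move=> /choice[C hC].
have C0 i : 0 <= C i by case: (hC i).
exists (\sum_i C i); first exact: sumr_ge0.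
move=> i; apply: bfun_mono (hC i) _.
by rewrite (bigD1 i)//= lerDl sumr_ge0.
Qed.

(** The dual vectors [u l] exist because the null space has the same dimension at [l]
    as at [l0]: [f] is injective on it and hence bijective. *)
Lemma local_system_exists l0 m : Om l0 -> has_codim (range (A l0)) m ->
  exists f (w : 'I_m -> Y) r C G E u, local_system l0 f w r C G E u.
Proof.
move=> O0 [w [wfree wspan]].
have [e [ei eE]] := null_dim O0.
have Ae := null_basis eE.
have [f [bf fe]] := dual_basis ei.
have [Cf Cf0 {}bf] := bfun_uniform bf.
have fl i a x y : f i (a *: x + y) = a * f i x + f i y by have [_ h _] := bf i.
have finj x : A l0 x = 0 -> (forall i, f i x = 0) -> x = 0.
  move=> Ax fx; have : nullspace (A l0) x by [].
  rewrite eE => -[a _ aE]; rewrite -aE big1// => j _.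
  by have := fx j; rewrite -aE (dual_coords _ fl fe) => ->; rewrite scale0r.
have brd0 : bordered (A l0) f w by apply: (bordered_intro fl finj Ae fe).
have [a a0 ba] := pencil_bound l0.
have [G0 [E0 inv0 [C0 C00 bGE]]] := bordered_inverse bf a0 ba brd0.
have [r1 r10 hO] := openP_nm Om_open O0.
pose D := 2 * (aS * C0) + 1.
have SC : 0 <= aS * C0 by rewrite mulr_ge0.
have D0 : 0 < D by rewrite /D; lra.
pose r := Num.min r1 D^-1.
have r0 : 0 < r by rewrite lt_min r10 invr_gt0.
have rO l : nm (l - l0) < r -> Om l by rewrite lt_min => /andP[/hO].
have small l : nm (l - l0) < r -> nm (l - l0) * aS * C0 <= 2^-1.
  rewrite lt_min => /andP[_]; rewrite -[D^-1]mul1r ltr_pdivlMr// /D.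
  by have := nm_ge0 (l - l0); set t := nm _ => *; nra.
have sh l x := pencil_shift l l0 x.
have brd l : nm (l - l0) < r -> bordered (A l) f w.
  by move=> hl; exact: (perturb_bordered bf (sh l) brd0 inv0 C00 bGE aS0 bS (small l hl)).
have /choice[GE hGE] : forall l, exists GE : (Y -> X) * (Y -> 'I_m -> K),
    nm (l - l0) < r -> inverse_of f w (A l) GE.1 GE.2.
  move=> l; case: (ltP (nm (l - l0)) r) => [hl|_]; last by exists (fun=> 0, fun _ _ => 0).
  have [al al0 bal] := pencil_bound l.
  by have [G [E inv _]] := bordered_inverse bf al0 bal (brd l hl); exists (G, E).
have /choice[u hu] : forall l, exists u : 'I_n -> X, nm (l - l0) < r ->
    (forall j, A l (u j) = 0) /\ (forall i j, f i (u j) = (i == j)%:R).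
  move=> l; case: (ltP (nm (l - l0)) r) => [hl|_]; last by exists (fun=> 0).
  have [|_ [u [Au fu]]] := null_dual (null_dim (rO l hl)) fl.
    right => x Ax fx; have [inj _] := brd l hl.
    have [] // := inj x (fun=> 0).
    by rewrite Ax add0r big1// => j _; rewrite scale0r.
  by exists u.
have h0 : nm (l0 - l0) < r by rewrite subrr nm0.
have [Au0 fu0] := hu l0 h0.
have E0E y j : (GE l0).2 y j = E0 y j.
  have [e1 f1] := hGE l0 h0 y.
  by have [_ ->] := bordered_uniq bf brd0 inv0 e1 f1.
pose U := \sum_j nm (u l0 j).
have U0 : 0 <= U by apply: sumr_ge0 => j _; exact: nm_ge0.
have uU j : nm (u l0 j) <= U.
  by rewrite /U (bigD1 j)//= lerDl sumr_ge0// => i _; exact: nm_ge0.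
have k1 : 0 <= 2 * C0 * C0 * aS by rewrite !mulr_ge0.
have k2 : 0 <= 2 * C0 * aS * U by rewrite !mulr_ge0.
pose C := Cf + 2 * C0 + 2 * C0 * C0 * aS + 2 * U + 2 * C0 * aS * U.
exists f, w, r, C, (fun l => (GE l).1), (fun l => (GE l).2), u.
split => //.
- by rewrite /C; lra.
- by move=> i; apply: bfun_mono (bf i) _; rewrite /C; lra.
- move=> l y hl; have [e1 f1] := hGE l hl y.
  have [h _ _] := perturb_bound bf (sh l) brd0 inv0 C00 bGE aS0 bS (small l hl) e1 f1.
  by apply: le_trans h _; rewrite ler_wpM2r ?nm_ge0// /C; lra.
- move=> l y j hl; have [e1 f1] := hGE l hl y.
  have [_ h _] := perturb_bound bf (sh l) brd0 inv0 C00 bGE aS0 bS (small l hl) e1 f1.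
  by apply: le_trans (h j) _; rewrite ler_wpM2r ?nm_ge0// /C; lra.
- move=> l y j hl; have [e1 f1] := hGE l hl y.
  have [_ _ h] := perturb_bound bf (sh l) brd0 inv0 C00 bGE aS0 bS (small l hl) e1 f1.
  rewrite E0E; apply: le_trans (h j) _; rewrite ler_wpM2r ?nm_ge0// ler_wpM2r ?nm_ge0//.
  by rewrite /C; lra.
- by move=> l j hl; have [-> _] := hu l hl.
- by move=> l i j hl; have [_ ->] := hu l hl.
- move=> l j hl; have [Au fu] := hu l hl.
  have [|h _] := perturb_null bf (sh l) brd0 inv0 C00 bGE aS0 bS (small l hl) (Au j) (Au0 j).
    by move=> i; rewrite fu fu0.
  by apply: le_trans h _; have := uU j; rewrite /C; lra.
- move=> l j hl; have [Au fu] := hu l hl.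
  have [|_ h] := perturb_null bf (sh l) brd0 inv0 C00 bGE aS0 bS (small l hl) (Au j) (Au0 j).
    by move=> i; rewrite fu fu0.
  apply: le_trans h _; rewrite mulrAC ler_wpM2r ?nm_ge0//.
  apply: (@le_trans _ _ (2 * C0 * aS * U)); last by rewrite /C; lra.
  by rewrite ler_wpM2l// !mulr_ge0.
Qed.

Lemma ls_linear m l0 f (w : 'I_m -> Y) r C G E u : local_system l0 f w r C G E u ->
  forall i a x y, f i (a *: x + y) = a * f i x + f i y.
Proof. by move=> ls i; have [_ h _] := ls_f ls i. Qed.

Lemma ls_free m l0 f (w : 'I_m -> Y) r C G E u l :
  local_system l0 f w r C G E u -> nm (l - l0) < r -> free_mod (A l) w.
Proof.
move=> ls hl.
apply: (bordered_free (ls_linear ls) (u := u l)) (ls_brd ls hl) => *;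
  [exact: (ls_null ls) | exact: (ls_dual ls)].
Qed.

Lemma local_system_codim m l0 f (w : 'I_m -> Y) r C G E u l :
  local_system l0 f w r C G E u -> nm (l - l0) < r -> has_codim (range (A l)) m.
Proof.
move=> ls hl; exists w; split; first exact: (ls_free ls hl).
move=> y; have [e1 _] := ls_inv ls hl y.
by exists (E l y), (G l y) => //; rewrite {2}e1 addrK.
Qed.

Hypothesis codim_ex : forall l, Om l -> exists m, has_codim (range (A l)) m.

(** Near each point of [Om] the codimension is that of the local bordered system. *)
Lemma codim_constant m l1 l : Om l1 -> has_codim (range (A l1)) m ->
  Om l -> has_codim (range (A l)) m.
Proof.
move=> O1 h1 Ol; move: h1.
apply: (@connected_locally_constant _ Om (fun l => has_codim (range (A l)) m) Om_conn _ _ _ O1 Ol).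
move=> l0 O0; have [k hk] := codim_ex O0.
have [f [w [r [C [G [E [u ls]]]]]]] := local_system_exists O0 hk.
exists r; first exact: (ls_r ls).
move=> l2 O2 hl; have hk2 := local_system_codim ls hl.
by split => h; [rewrite (has_codim_uniq h hk2) | rewrite (has_codim_uniq h hk)].
Qed.

Definition annih l (g : X -> K) := forall x, A l x = 0 -> g x = 0.

(** A functional is tested on the basis [u l].  If [g] vanishes on the null space at [l0],
    then [g = g o G l0 o A l0], and [A l0 x = (l - l0) S x] on the null space at [l]. *)
Lemma null_frame m l0 f (w : 'I_m -> Y) r C G E u : local_system l0 f w r C G E u ->
  exists C' L q, frame (@bfun R X) Om annih (n := n) l0 r C' L q.
Proof.
move=> ls.
have C0 := ls_C ls.
have h0 : nm (l0 - l0) < r by rewrite subrr nm0; exact: (ls_r ls).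
have CS : 0 <= C * aS by rewrite mulr_ge0.
exists (C + C * aS), (fun g x => g (G l0 (S x))), (fun l g j => g (u l j)).
split.
- exact: (ls_r ls).
- exact: addr_ge0.
- by move=> l hl a g1 g2 j.
- move=> l hl g M bg; split => [h j|h x Ax]; first exact/h/(ls_null ls).
  have [inj _] := ls_brd ls hl.
  have xE : x = \sum_i f i x *: u l i.
    apply/eqP; rewrite -subr_eq0; apply/eqP.
    have [] // := inj (x - \sum_i f i x *: u l i) (fun=> 0).
      rewrite linearB Ax linear_comb !big1 ?subr0 ?addr0// => i _; rewrite ?scale0r//.
      by rewrite (ls_null ls _ hl) scaler0.
    move=> i; rewrite (bfun_B (ls_f ls i)).
    by rewrite (dual_coords _ (ls_linear ls) (fun i j => ls_dual ls i j hl)) subrr.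
  rewrite xE (bfun_sum bg) big1// => i _.
  by rewrite (bfun_Z bg) h mulr0.
- move=> l hl g M j M0 [_ _ bg]; apply: le_trans (bg _) _; rewrite mulrC ler_wpM2r//.
  by apply: le_trans (ls_u ls j hl) _; rewrite lerDl.
- move=> l hl g M j M0 bg; have [_ _ gb] := bg; rewrite -(bfun_B bg).
  apply: le_trans (gb _) _; rewrite (mulrC _ M) -mulrA ler_wpM2l//.
  apply: le_trans (ls_uc ls j hl) _; rewrite ler_wpM2r ?nm_ge0//.
  by rewrite lerDl.
move=> g M bg Zg; have [M0 gl gb] := bg.
have G0 a y y' : G l0 (a *: y + y') = a *: G l0 y + G l0 y'.
  by have [] := inverse_lin (ls_f ls) (ls_brd ls h0) (ls_inv ls h0) a y y'.
split.
  split => [|a x y|x]; first by rewrite mulr_ge0// addr_ge0.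
    by rewrite linearP G0 gl.
  apply: le_trans (gb _) _; rewrite (mulrC _ M) -mulrA ler_wpM2l//.
  apply: le_trans (ls_G ls _ h0) _.
  apply: (@le_trans _ _ (C * (aS * nm x))); first by rewrite ler_wpM2l.
  by rewrite mulrA ler_wpM2r ?nm_ge0// lerDr.
move=> l Ol x Ax.
have -> : (g - (l - l0) *: (fun x => g (G l0 (S x)))) x = g x - (l - l0) * g (G l0 (S x)) by [].
have E1 : A l0 x = (l - l0) *: S x.
  by apply/eqP; rewrite -subr_eq0 -pencil_shift Ax.
have G00 : G l0 0 = 0 by have := G0 (-1) 0 0; rewrite scaler0 addr0 scaleN1r addNr.
rewrite -(bfun_Z bg) -(bfun_B bg).
have -> : (l - l0) *: G l0 (S x) = G l0 (A l0 x) by rewrite E1 -[(l - l0) *: S x]addr0 G0 G00 addr0.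
apply: Zg; rewrite linearB; have [e1 _] := ls_inv ls h0 (A l0 x).
have Ez : forall j, E l0 (A l0 x) j = 0.
  apply: (ls_free ls h0); exists (x - G l0 (A l0 x)) => //.
  by rewrite linearB {1}e1 addrAC subrr add0r.
rewrite {1}e1 big1 ?addr0 ?subrr// => j _.
by rewrite Ez scale0r.
Qed.

(** The coordinates [E l] are those of the class modulo the range.  For [y = A l0 (G l0 y)],
    the difference [y - A l (G l0 y)] equals [(l - l0) S (G l0 y)]. *)
Lemma range_frame m l0 f (w : 'I_m -> Y) r C G E u : local_system l0 f w r C G E u ->
  exists C' L q, frame (fun y M => nm y <= M) Om (fun l y => range (A l) y) (n := m) l0 r C' L q.
Proof.
move=> ls.
have C0 := ls_C ls.
have h0 : nm (l0 - l0) < r by rewrite subrr nm0; exact: (ls_r ls).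
have CS : 0 <= C * aS by rewrite mulr_ge0.
have ker l y : nm (l - l0) < r -> (range (A l) y <-> forall j, E l y j = 0).
  move=> hl; have [e1 _] := ls_inv ls hl y; split => [[x _ xE]|hE]; last first.
    exists (G l y) => //; rewrite {2}e1 big1 ?addr0// => j _.
    by rewrite hE scale0r.
  apply: (ls_free ls hl); exists (x - G l y) => //.
  by rewrite linearB xE {1}e1 addrAC subrr add0r.
exists (C + C * aS), (fun y => S (G l0 y)), E.
split.
- exact: (ls_r ls).
- exact: addr_ge0.
- move=> l hl a y y' j.
  by have [_ ->] := inverse_lin (ls_f ls) (ls_brd ls hl) (ls_inv ls hl) a y y'.
- by move=> l hl y M _; exact: ker.
- move=> l hl y M j M0 yM; apply: le_trans (ls_E ls y j hl) _.
  by apply: ler_pM => //; [exact: nm_ge0 | rewrite lerDl].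
- move=> l hl y M j M0 yM; apply: le_trans (ls_Ec ls y j hl) _.
  rewrite mulrAC ler_wpM2r ?nm_ge0//.
  by apply: ler_pM => //; [exact: nm_ge0 | rewrite lerDl].
move=> y M yM Zy; split.
  apply: le_trans (bS _) _.
  apply: (@le_trans _ _ (aS * (C * nm y))).
    by rewrite ler_wpM2l//; exact: (ls_G ls).
  rewrite mulrA (mulrC aS); apply: ler_pM => //; first exact: nm_ge0.
  by rewrite lerDr.
move=> l Ol; exists (G l0 y) => //; rewrite (pencil_shift l l0); congr (_ - _).
have [e1 _] := ls_inv ls h0 y; rewrite {2}e1 big1 ?addr0// => j _.
by have /(ker _ _ h0) -> := Zy; rewrite scale0r.
Qed.

Section Global.
Variables (l1 : K) (m : nat) (Kc : set K).
Hypothesis O1 : Om l1.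
Hypothesis codim1 : has_codim (range (A l1)) m.
Hypothesis cK : compact Kc.
Hypothesis KO : Kc `<=` Om.

Lemma local_systems l0 : Om l0 ->
  exists f (w : 'I_m -> Y) r C G E u, local_system l0 f w r C G E u.
Proof. by move=> O0; apply: local_system_exists => //; exact: codim_constant O1 _ O0. Qed.

Lemma global_functionals : exists2 f : 'I_n -> X -> K,
  exists2 C : R, 0 <= C & forall i, bfun (f i) C &
  forall l, Kc l -> forall c : 'I_n -> K,
    (forall x, A l x = 0 -> \sum_i c i * f i x = 0) -> forall i, c i = 0.
Proof.
have [f [w [r [C [G [E [u ls]]]]]]] := local_systems O1.
have h1 : nm (l1 - l1) < r by rewrite subrr nm0; exact: (ls_r ls).
have sumE (c : 'I_n -> K) (g : 'I_n -> X -> K) x : (\sum_i c i *: g i) x = \sum_i c i * g i x.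
  by rewrite fct_sumE.
have [||||||||g [Cg Cg0 bg] hg] := @remove_all_zeros _ (X -> K) (@bfun R X) Om annih n
  _ _ _ _ _ _ Om_open Om_conn f l1 Kc _ O1 _ cK KO.
- by move=> v M M'; exact: bfun_mono.
- exact: bfun0.
- by move=> v v' M M'; exact: bfunD.
- by move=> a v M; exact: bfunZ.
- by move=> l a g Ol Zg x /Zg gx; rewrite scale_funE gx mulr0.
- move=> l0 /local_systems[f' [w' [r' [C' [G' [E' [u' ls']]]]]]].
  have [C2 [L [q fr]]] := null_frame ls'.
  by exists r', C2, L, q.
- by exists C; [exact: (ls_C ls) | exact: (ls_f ls)].
- move=> c Zc i; have := Zc (u l1 i) (ls_null ls i h1).
  rewrite sumE (bigD1 i)//= (ls_dual ls)// eqxx mulr1 big1 ?addr0// => j ji.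
  by rewrite (ls_dual ls)// (negPf ji) mulr0.
exists g; first by exists Cg.
by move=> l Kl c hc; apply: (hg l Kl) => x /hc; rewrite sumE.
Qed.

Lemma global_vectors : exists w : 'I_m -> Y, forall l, Kc l -> free_mod (A l) w.
Proof.
have [f [w [r [C [G [E [u ls]]]]]]] := local_systems O1.
have h1 : nm (l1 - l1) < r by rewrite subrr nm0; exact: (ls_r ls).
have [||||||||g _ hg] := @remove_all_zeros _ Y (fun y M => nm y <= M) Om
  (fun l y => range (A l) y) m _ _ _ _ _ _ Om_open Om_conn w l1 Kc _ O1 _ cK KO.
- by move=> y M M'; exact: le_trans.
- by rewrite nm0.
- by move=> y y' M M' h h'; apply: le_trans (nmD _ _) (lerD h h').
- by move=> a y M h; rewrite nmZ ler_wpM2l ?nm_ge0.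
- by move=> l a y _; exact: rangeZ.
- move=> l0 /local_systems[f' [w' [r' [C' [G' [E' [u' ls']]]]]]].
  have [C2 [L [q fr]]] := range_frame ls'.
  by exists r', C2, L, q.
- exists (\sum_j nm (w j)); first by apply: sumr_ge0 => j _; exact: nm_ge0.
  by move=> j; rewrite (bigD1 j)//= lerDl sumr_ge0// => i _; exact: nm_ge0.
- exact: (ls_free ls h1).
by exists g.
Qed.

Lemma global_bordered : exists f : 'I_n -> X -> K, exists2 w : 'I_m -> Y,
  exists C, forall i, bfun (f i) C &
  forall l, Kc l -> bordered (A l) f w /\ free_mod (A l) w.
Proof.
have [f [C C0 bf] hf] := global_functionals; have [w hw] := global_vectors.
exists f, w; first by exists C.
move=> l Kl; have fl i a x y : f i (a *: x + y) = a * f i x + f i y by have [_ h _] := bf i.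
have [finj [u [Au fu]]] := null_dual (null_dim (KO Kl)) fl (or_introl (hf l Kl)).
split; last exact: hw.
apply: (bordered_intro fl finj Au fu (hw l Kl)).
by apply: free_mod_spanning (hw l Kl) _; exact: codim_constant O1 codim1 (KO Kl).
Qed.

(** The three identities are instances of unique solvability: a pair [(x, c)]
    solving the bordered system at [l] determines [G l y = x].  For the resolvent identity, the
    solution at [l'] for [y] plus [l - l'] times the solution at [l] for [S (G l' y)] solves
    the system at [l] for [y]. *)
Lemma resolvent_exists (U : set K) : U `<=` Kc ->
  exists G : K -> {linear Y -> X}, generalized_resolvent T S U G.
Proof.
move=> UK; have [f [w [C bf] brd_free]] := global_bordered.
have brd l : Kc l -> bordered (A l) f w by case/brd_free.
have /choice[G hG] : forall l, exists G : {linear Y -> X}, Kc l ->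
    bounded_operator G /\ exists E, inverse_of f w (A l) G E.
  move=> l; have [Kl|nK] := pselect (Kc l); last by exists (\0)%R.
  have [a a0 ba] := pencil_bound l.
  have [G [E inv [D D0 bGE]]] := bordered_inverse bf a0 ba (brd l Kl).
  have Glin : linear G.
    by move=> c y y'; have [] := inverse_lin bf (brd l Kl) inv c y y'.
  pose GL : {linear Y -> X} := HB.pack G (GRing.isLinear.Build _ _ _ _ _ Glin).
  exists GL => _; split; last by exists E.
  by apply/bounded_operatorP; exists D => // y; have [] := bGE y.
have solve l x c y : Kc l -> y = A l x + \sum_j c j *: w j -> (forall i, f i x = 0) -> G l y = x.
  move=> Kl yE fx; have [_ [E inv]] := hG l Kl.
  by have [<- _] := bordered_uniq bf (brd l Kl) inv yE fx.
have spec l y : Kc l -> exists2 c, y = A l (G l y) + \sum_j c j *: w j & forall i, f i (G l y) = 0.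
  by move=> Kl; have [_ [E inv]] := hG l Kl; have [h1 h2] := inv y; exists (E y).
exists G; split.
- by move=> l /UK Kl; have [] := hG l Kl.
- move=> l /UK Kl x /=; have [c cE fG] := spec l (A l x) Kl.
  have [_ free] := brd_free l Kl.
  have c0 : forall j, c j = 0.
    apply: free; exists (x - G l (A l x)) => //.
    by rewrite linearB {1}cE addrAC subrr add0r.
  by rewrite [RHS]cE big1 ?addr0// => j _; rewrite c0 scale0r.
- move=> l /UK Kl y /=; have [c cE fG] := spec l y Kl.
  apply: (solve l _ (fun=> 0)) => //.
  by rewrite big1 ?addr0// => j _; rewrite scale0r.
- move=> l l' /UK Kl /connected_component_sub/UK Kl' y.
  have [c cE fx] := spec l' y Kl'; set x := G l' y in cE fx *.
  have [d dE fz] := spec l (S x) Kl.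
  suff -> : G l y = x + (l - l') *: G l (S x) by rewrite addrAC subrr add0r.
  rewrite addrC; apply: (solve l _ (fun j => (l - l') * d j + c j)) => //.
    by rewrite bordered_lin -dE (pencil_shift l l') addrCA addrA subrK.
  by move=> i; have [_ fl _] := bf i; rewrite fl fx fz mulr0 addr0.
Qed.

End Global.
End Pencil.

(** * The generalized resolvent *)

Theorem theorem4p1 (R : realType) (X Y : completeNormedModType (Cplx R))
    (T S : {linear X -> Y}) (Omega U : set (Cplx R)) :
  bounded_operator T -> bounded_operator S ->
  open Omega -> connected Omega ->
  (forall l, Omega l -> fredholm (pencil T S l)) ->
  (exists n, forall l, Omega l -> has_dim (nullspace (pencil T S l)) n) ->
  bounded_set U -> open U -> connected U -> closure U `<=` Omega ->
  exists G : Cplx R -> {linear Y -> X}, generalized_resolvent T S U G.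
Proof.
move=> /bounded_operatorP[aT aT0 bT] /bounded_operatorP[aS aS0 bS] oO cO fr [n nd] bU _ _ clU.
have codim_ex l : Omega l -> exists m, has_codim (range (pencil T S l)) m.
  by move=> /fr[].
have [[l1 Ul1]|U0] := pselect (U !=set0); last first.
  exists (fun=> \0); have nU l : ~ U l by move=> Ul; apply: U0; exists l.
  by split=> [l /nU|l /nU|l /nU|l l2 /nU].
have O1 : Omega l1 by apply/clU/subset_closure.
have [m hm] := codim_ex l1 O1.
apply: (resolvent_exists aT0 bT aS0 bS oO cO nd codim_ex O1 hm _ clU (@subset_closure _ U)).
exact: bounded_closure_compact.
Qed.
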